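(* Let $n\ge 1$. The groupoid $\mathrm{BDiff}(S^1,n)\rightrightarrows B$ of broken circle diffeomorphisms admits a nontrivial $n$-dimensional central extension given by $\chi=(\chi_1,\dots,\chi_n)$, where for composable $\phi,\psi$ with $\mathrm{src}(\psi)=(p_1,\dots,p_n)$ $$\chi_i(\phi,\psi)=\int_{p_i}^{p_{i+1}}\log(\phi_x\circ\psi)\,d\log(\psi_x),\qquad i=1,\dots,n .$$ That is, $\chi$ satisfies the groupoid cocycle identity $$\chi(\phi,\psi\circ\eta)+\chi(\psi,\eta)=\chi(\phi\circ\psi,\eta)+\chi(\phi,\psi)$$ for all composable triples $(\phi,\psi,\eta)$, so that $\mathrm{BDiff}(S^1,n)\times\mathbb R^n$ with multiplication $(\phi,t)\cdot(\psi,s)=(\phi\circ\psi,\,t+s+\chi(\phi,\psi))$ is a groupoid over $B$; and $\chi$ is not a coboundary.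
   Context: $S^1=\mathbb R/\mathbb Z$; $B\subset(S^1)^n$ is the manifold of $n$-tuples $p=(p_1,\dots,p_n)$ of distinct cyclically ordered points; $p_{n+1}:=p_1$. $[p_i,p_{i+1}]$ is the positively oriented arc from $p_i$ to $p_{i+1}$ (for $n=1$, the whole circle cut at $p_1$), and integrals over it use one-sided derivatives at its ends. The broken diffeomorphism groupoid $\mathrm{BDiff}(S^1,n)\rightrightarrows B$: an arrow with source $p\in B$ is an orientation-preserving homeomorphism $\phi:S^1\to S^1$ whose restriction to each closed arc $[p_j,p_{j+1}]$ is a smooth diffeomorphism (up to the boundary) onto its image; $p$ is part of the data of the arrow. Its source is $\mathrm{src}(\phi)=p$ and its target is $\mathrm{trg}(\phi)=\phi(p)=(\phi(p_1),\dots,\phi(p_n))$. The composition $\phi\circ\psi$ is defined when $\mathrm{src}(\phi)=\mathrm{trg}(\psi)$ and is composition of homeomorphisms; a triple $(\phi,\psi,\eta)$ is composable if $\mathrm{src}(\phi)=\mathrm{trg}(\psi)$ and $\mathrm{src}(\psi)=\mathrm{trg}(\eta)$. Here $\phi_x$ is the derivative, defined on each arc. Smooth structure: reparametrizing each source arc and each image arc affinely by $[0,1]$ identifies $\mathrm{BDiff}(S^1,n)$ with $B\times B\times \mathrm{Diff}_+([0,1])^n$ (source, target, reparametrized restrictions to the $n$ arcs), a Fréchet manifold. An $\mathbb R^n$-valued groupoid $2$-cocycle $\chi$ is a coboundary if there is a smooth function $f:\mathrm{BDiff}(S^1,n)\to\mathbb R^n$ with $\chi(\phi,\psi)=f(\phi)+f(\psi)-f(\phi\circ\psi)$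 for all composable $\phi,\psi$; the central extension is nontrivial if $\chi$ is not a coboundary. *)

(* Defs.v *)
From HB Require Import structures.
From mathcomp Require Import all_boot all_order all_algebra.
From mathcomp Require Import all_classical all_reals all_analysis.

Set Implicit Arguments.
Unset Strict Implicit.
Unset Printing Implicit Defensive.
Import Order.TTheory GRing.Theory Num.Theory.
Import numFieldNormedType.Exports.
Local Open Scope classical_set_scope.
Local Open Scope ring_scope.

Section Derivative_within.
Context {R : realType}.
Implicit Types (A : set R) (f g : R -> R).

(* Derivative relative to [A]: at an endpoint of an interval [A] it is the
   one-sided derivative, and the values of [f] outside [A] play no role. *)
Definition diff_quot_in A f (x : R) : set_system R :=
  (fun y => (f y - f x) / (y - x)) @ within A x^'.

Definition derivable_in A f (x : R) : Prop := cvg (diff_quot_in A f x).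

Definition derive_in A f (x : R) : R := lim (diff_quot_in A f x).

Definition derive_in_n A (k : nat) f : R -> R := iter k (derive_in A) f.

Definition smooth_in A f : Prop :=
  forall (k : nat) (x : R), A x -> derivable_in A (derive_in_n A k f) x.

(* Orientation-preserving C^oo diffeomorphism, up to the boundary, of [a, b]
   onto [f a, f b]. *)
Definition diffeo_on (a b : R) f : Prop :=
  [/\ smooth_in `[a, b] f, f @` `[a, b] = `[f a, f b]%classic &
      exists2 g, smooth_in `[f a, f b] g & {in `[a, b], cancel f g}].

End Derivative_within.

Section Circle.
Context (R : realType).

Definition circle_rel (x y : R) : bool := x - y \is a Num.int.

Lemma circle_rel_refl : reflexive circle_rel.
Proof. by move=> x; rewrite /circle_rel subrr rpred0. Qed.

Lemma circle_rel_sym : symmetric circle_rel.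
Proof. by move=> x y; rewrite /circle_rel -opprB rpredN. Qed.

Lemma circle_rel_trans : transitive circle_rel.
Proof.
by move=> y x z xy yz; rewrite /circle_rel -(subrKA y) rpredD.
Qed.

Canonical circle_equiv :=
  EquivRel circle_rel circle_rel_refl circle_rel_sym circle_rel_trans.

Definition S1 := quotient_topology {eq_quot circle_equiv}%qT.

HB.instance Definition _ := Topological.on S1.
HB.instance Definition _ := Quotient.on S1.

Definition toS1 (x : R) : S1 := \pi_S1%qT x.

Definition homeo (phi : S1 -> S1) : Prop :=
  continuous phi /\
  exists psi : S1 -> S1, [/\ continuous psi, cancel phi psi & cancel psi phi].

Definition is_lift (phi : S1 -> S1) (F : R -> R) : Prop :=
  [/\ continuous F, {homo F : x y / x < y}, forall x, F (x + 1) = F x + 1 &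
      forall x, toS1 (F x) = phi (toS1 x)].

(* A lift of [phi]; unique up to an integer constant when there is one. *)
Definition lift_of (phi : S1 -> S1) : R -> R :=
  xget (id : R -> R) [set F | is_lift phi F].

(* [a, b] is a lift of the positively oriented arc from [p] to [q]; when
   [p = q] the arc is the whole circle cut at [p], i.e. [b = a + 1]. *)
Definition is_arc_lift (p q : S1) (ab : R * R) : Prop :=
  [/\ toS1 ab.1 = p, toS1 ab.2 = q & ab.1 < ab.2 <= ab.1 + 1].

Definition arc_lift (p q : S1) : R * R :=
  xget (0, 0) [set ab | is_arc_lift p q ab].

(* Affine parametrization by [0, 1] of the arc from [p] to [q]. *)
Definition arc_pt (p q : S1) (t : R) : S1 :=
  toS1 ((arc_lift p q).1 + t * ((arc_lift p q).2 - (arc_lift p q).1)).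

End Circle.

Section Broken_diffeomorphisms.
Context (R : realType) (n : nat).

Definition config := 'I_n -> S1 R.

Definition Bconf : set config := [set p | exists x : 'I_n -> R,
  [/\ forall i, toS1 (x i) = p i,
      forall i j : 'I_n, (i < j)%N -> x i < x j &
      forall i j, x j < x i + 1]].

Definition arrow : Type := config * (S1 R -> S1 R).

Definition src (a : arrow) : config := a.1.
Definition trg (a : arrow) : config := a.2 \o a.1.
Definition bcomp (a b : arrow) : arrow := (b.1, a.2 \o b.2).

(* [ordS] is the cyclic successor, so the [i]-th arc runs from [p_i] to
   [p_(i+1)], with [p_(n+1) = p_1]. *)
Definition src_arc (a : arrow) (i : 'I_n) : R * R :=
  arc_lift (src a i) (src a (ordS i)).

Definition BDiff : set arrow := [set a | [/\ Bconf (src a), homeo a.2 &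
  exists2 F, is_lift a.2 F &
    forall i, diffeo_on (src_arc a i).1 (src_arc a i).2 F]].

(* With lifts [F], [G] of [phi], [psi] and [s, t] of the i-th source arc of
   [psi], the i-th source arc of [phi] lifts to [G s, G t]; the Stieltjes
   integrator [d log (psi_x)] is [(log psi_x)_x dx]. *)
Definition chi (phi psi : arrow) : 'rV[R]_n := \row_i
  let F := lift_of phi.2 in let G := lift_of psi.2 in
  let s := (src_arc psi i).1 in let t := (src_arc psi i).2 in
  \int[lebesgue_measure]_(x in `[s, t])
    (ln (derive_in `[G s, G t] F (G x)) *
     derive_in `[s, t] (fun z => ln (derive_in `[s, t] G z)) x).

End Broken_diffeomorphisms.

(* A (set-theoretic) groupoid on the objects [O] and the arrows [M]; [mul g h]
   is relevant only when [src g = trg h]. *)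
Definition is_groupoid (TO TM : Type) (O : set TO) (M : set TM)
    (src trg : TM -> TO) (mul : TM -> TM -> TM) : Prop :=
  [/\ forall g, M g -> O (src g) /\ O (trg g),
      forall g h, M g -> M h -> src g = trg h ->
        [/\ M (mul g h), src (mul g h) = src h & trg (mul g h) = trg g],
      forall g h k, M g -> M h -> M k -> src g = trg h -> src h = trg k ->
        mul g (mul h k) = mul (mul g h) k &
      exists id : TO -> TM,
        (forall x, O x -> [/\ M (id x), src (id x) = x & trg (id x) = x]) /\
        (forall g, M g ->
          [/\ mul g (id (src g)) = g, mul (id (trg g)) g = g &
            exists h, [/\ M h, src h = trg g, trg h = src g,
                      mul h g = id (src g) & mul g h = id (trg g)]])].

Section Extension.
Context (R : realType) (n : nat).

Definition cocycle (c : arrow R n -> arrow R n -> 'rV[R]_n) : Prop :=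
  forall phi psi eta, BDiff phi -> BDiff psi -> BDiff eta ->
    src phi = trg psi -> src psi = trg eta ->
    c phi (bcomp psi eta) + c psi eta = c (bcomp phi psi) eta + c phi psi.

Definition ext_arrow : Type := arrow R n * 'rV[R]_n.
Definition ext_src (a : ext_arrow) : config R n := src a.1.
Definition ext_trg (a : ext_arrow) : config R n := trg a.1.
Definition ext_mul c (a b : ext_arrow) : ext_arrow :=
  (bcomp a.1 b.1, a.2 + b.2 + c a.1 b.1).

End Extension.

(* C^k maps on an open subset of a locally convex space, in the sense of
   Michal-Bastiani (Hamilton, for Frechet spaces): the directional derivatives
   exist and are jointly C^(k-1) in the point and the direction. *)
Section Ck_maps.
Context {R : realType} {F : normedModType R}.

Definition has_dir_derivative (E : tvsType R) (f : E -> F) (x v : E) (l : F) :=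
  (fun t : R => t^-1 *: (f (x + t *: v) - f x)) @ 0^' --> l.

Fixpoint Ck_on (k : nat) : forall E : tvsType R, set E -> (E -> F) -> Prop :=
  match k with
  | 0%N => fun E U f => forall x, U x -> {for x, continuous f}
  | k'.+1 => fun E U f => (forall x, U x -> {for x, continuous f}) /\
      exists df : E * E -> F,
        (forall x v, U x -> has_dir_derivative f x v (df (x, v))) /\
        @Ck_on k' (E * E)%type [set xv | U xv.1] df
  end.

Definition Coo_on (E : tvsType R) (U : set E) (f : E -> F) : Prop :=
  forall k, Ck_on k U f.

End Ck_maps.

(* The Frechet space of n-tuples of functions on [0, 1], smooth up to the
   boundary and zero at 0 and 1, with the topology of uniform convergence of
   all derivatives; Diff_+([0, 1])^n is an open subset of its translate by
   (id, ..., id). The functions are extended by 0 outside [0, 1]. *)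
Section Displacements.
Context (R : realType) (n : nat).

Local Notation I01 := (`[0%R, 1%R]%classic : set R).
Local Notation D := (derive_in_n I01).

Definition disp_pred : {pred ('I_n -> R -> R)} := fun h =>
  `[< (forall i, smooth_in I01 (h i)) /\
      (forall i t, t \notin `]0, 1[ -> h i t = 0) >].

Lemma within_proper (x : R) : I01 x -> ProperFilter (within I01 x^').
Proof.
rewrite /= in_itv/= => /andP[x0 x1]; apply: Build_ProperFilter_ex.
move=> P /nbhs_ballP[e /= e0 He].
pose d := Num.min (e / 2) (1 / 2).
have d0 : 0 < d by rewrite lt_min !divr_gt0.
have de : d < e.
  by rewrite gt_min ltr_pdivrMr// ltr_pMr// ltr1n.
have d12 : d <= 1 / 2 by rewrite ge_min lexx orbT.
have [xh|xh] := leP x (1 / 2).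
- exists (x + d); apply: He => /=.
  + by rewrite /ball/= opprD addNKr normrN gtr0_norm.
  + by rewrite -subr_eq0 addrAC subrr add0r gt_eqF.
  + rewrite in_itv/= addr_ge0 ?(ltW d0)//=.
    by rewrite (le_trans (lerD xh d12))// -splitr.
- exists (x - d); apply: He => /=.
  + by rewrite /ball/= opprB addrC subrK gtr0_norm.
  + by rewrite -subr_eq0 addrAC subrr add0r oppr_eq0 gt_eqF.
  + rewrite in_itv/= subr_ge0 (le_trans d12 (ltW xh))/=.
    by rewrite (le_trans _ x1)// gerBl ltW.
Qed.

Lemma eq_diff_quot (f g : R -> R) (x : R) : {in I01, f =1 g} -> I01 x ->
  diff_quot_in I01 f x = diff_quot_in I01 g x.
Proof.
move=> fg Ix; rewrite /diff_quot_in; apply/funext => P; apply/propext.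
suff H (f' g' : R -> R) : {in I01, f' =1 g'} ->
    ((fun y => (f' y - f' x) / (y - x)) @ within I01 x^') P ->
    ((fun y => (g' y - g' x) / (y - x)) @ within I01 x^') P.
  by split; apply: H => // y yI; rewrite fg.
move=> {}fg H; change (nbhs x^' (fun y => I01 y -> P ((g' y - g' x) / (y - x)))).
apply: filterS (H : nbhs x^' (fun y => I01 y -> P ((f' y - f' x) / (y - x)))).
by move=> y Py yI; rewrite -!fg ?inE//; exact: Py.
Qed.

Lemma eqD (f g : R -> R) k : {in I01, f =1 g} -> {in I01, D k f =1 D k g}.
Proof.
move=> fg; elim: k => [|k IH] //= x /[!inE] xI.
by rewrite /derive_in (eq_diff_quot IH).
Qed.

Lemma diff_quot_lin (a : R) (f g : R -> R) (x : R) : I01 x ->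
  derivable_in I01 f x -> derivable_in I01 g x ->
  diff_quot_in I01 (a *: f + g) x --> a * derive_in I01 f x + derive_in I01 g x.
Proof.
move=> Ix df dg; have FF := within_proper Ix.
rewrite /diff_quot_in (_ : (fun y => _) = (fun y : R =>
  a * ((f y - f x) / (y - x)) + ((g y - g x) / (y - x)))); last first.
  apply/funext => y; rewrite -[(a *: f + g) y]/(a * f y + g y).
  rewrite -[(a *: f + g) x]/(a * f x + g x).
  by rewrite opprD addrACA -mulrBr mulrDl mulrA.
by apply: cvgD; [apply: cvgMl_tmp|]; [exact: df|exact: dg].
Qed.

Lemma derive_lin (a : R) (f g : R -> R) (x : R) : I01 x ->
  derivable_in I01 f x -> derivable_in I01 g x ->
  derive_in I01 (a *: f + g) x = a * derive_in I01 f x + derive_in I01 g x.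
Proof.
move=> Ix df dg; have FF := within_proper Ix.
by apply: cvg_lim => //; exact: diff_quot_lin.
Qed.

Lemma D_lin (a : R) (f g : R -> R) k : smooth_in I01 f -> smooth_in I01 g ->
  {in I01, D k (a *: f + g) =1 a *: D k f + D k g}.
Proof.
move=> sf sg; elim: k => [//|k IH] x /[!inE] xI.
rewrite /= /derive_in (eq_diff_quot IH)//.
by apply: derive_lin => //; [exact: sf|exact: sg].
Qed.

Lemma smooth_lin (a : R) (f g : R -> R) : smooth_in I01 f -> smooth_in I01 g ->
  smooth_in I01 (a *: f + g).
Proof.
move=> sf sg k x Ix; rewrite /derivable_in (eq_diff_quot (D_lin a k sf sg))//.
by apply/cvg_ex; eexists; apply: diff_quot_lin => //; [exact: sf|exact: sg].
Qed.

Lemma smooth0 : smooth_in I01 (0 : R -> R).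
Proof.
suff H k : {in I01, D k (0 : R -> R) =1 0}.
  move=> k x Ix; rewrite /derivable_in (eq_diff_quot (H k))//.
  have FF := within_proper Ix.
  rewrite /diff_quot_in (_ : (fun y => _) = cst 0); first exact: is_cvg_cst.
  by apply/funext => y; rewrite /= subrr mul0r.
elim: k => [//|k IH] x /[!inE] xI.
rewrite /= /derive_in (eq_diff_quot IH)//.
have FF := within_proper xI; apply: cvg_lim => //.
rewrite /diff_quot_in (_ : (fun y => _) = cst 0); first exact: cvg_cst.
by apply/funext => y; rewrite /= subrr mul0r.
Qed.

Lemma disp_pred_submod : submod_closed disp_pred.
Proof.
split.
  by apply/asboolP; split => // i; exact: smooth0.
move=> a h g /asboolP[sh h0] /asboolP[sg g0]; apply/asboolP; split => i.
  exact: smooth_lin.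
move=> t tI; rewrite [LHS](_ : _ = a * h i t + g i t)// h0// g0// mulr0.
by rewrite addr0.
Qed.

HB.instance Definition _ :=
  GRing.isSubmodClosed.Build R ('I_n -> R -> R) disp_pred disp_pred_submod.

Record disp := Disp { disp_fun :> 'I_n -> R -> R; _ : disp_fun \in disp_pred }.

HB.instance Definition _ := [isSub for disp_fun].
HB.instance Definition _ := [Choice of disp by <:].
HB.instance Definition _ := [SubChoice_isSubLmodule of disp by <:].

(* The C^k norm of [h] is at most [c]. *)
Definition disp_le (k : nat) (h : disp) (c : R) : Prop :=
  forall i j t, (j <= k)%N -> t \in `[0, 1] -> `|D j (h i) t| <= c.

Definition disp_open (U : set disp) : Prop :=
  forall f, U f -> exists k, exists2 e, 0 < e &
    forall g, disp_le k (g - f) e -> U g.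

Lemma disp_openT : disp_open setT.
Proof. by move=> f _; exists 0%N, 1. Qed.

Lemma disp_openI : setI_closed disp_open.
Proof.
move=> U V oU oV f [/oU[k [e e0 eU]] /oV[l [d d0 dV]]].
exists (maxn k l), (Num.min e d); first by rewrite lt_min e0.
move=> g gf; split; [apply: eU|apply: dV] => i j t jk tI;
  (apply: le_trans (gf _ _ _ _ tI) _; last by rewrite ge_min lexx ?orbT).
  by rewrite leq_max jk.
by rewrite leq_max jk orbT.
Qed.

Lemma disp_open_bigU (I : Type) (U : I -> set disp) :
  (forall i, disp_open (U i)) -> disp_open (\bigcup_i U i).
Proof.
move=> oU f [i _ /oU[k [e e0 eU]]]; exists k, e => // g /eU Ug.
by exists i.
Qed.

HB.instance Definition _ :=
  isOpenTopological.Build disp disp_openT disp_openI disp_open_bigU.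

Lemma disp_smooth (h : disp) i : smooth_in I01 (h i).
Proof. by case: h => h /= /asboolP[]. Qed.

Lemma D_disp (a : R) (h g : disp) i k (t : R) : t \in `[0, 1] ->
  D k ((a *: h + g : disp) i) t = a * D k (h i) t + D k (g i) t.
Proof.
by move=> tI; rewrite [LHS](D_lin a k (@disp_smooth h i) (@disp_smooth g i)) ?inE.
Qed.

Lemma disp_leD k (h g : disp) c d :
  disp_le k h c -> disp_le k g d -> disp_le k (h + g) (c + d).
Proof.
move=> hc gd i j t jk tI; rewrite -[h]scale1r D_disp// mul1r.
by rewrite (le_trans (ler_normD _ _))// lerD ?hc ?gd.
Qed.

Lemma D_disp0 i k (t : R) : t \in `[0, 1] -> D k ((0 : disp) i) t = 0.
Proof.
move=> tI; have := D_disp (-1) 0 0 i k tI.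
by rewrite scaler0 addr0 mulN1r addNr.
Qed.

Lemma disp_leZ k (h : disp) a c : disp_le k h c -> disp_le k (a *: h) (`|a| * c).
Proof.
move=> hc i j t jk tI; rewrite -[_ *: _]addr0 D_disp// D_disp0// addr0.
by rewrite normrM ler_wpM2l// hc.
Qed.

Lemma disp_leW k l (h : disp) c d : (l <= k)%N -> c <= d ->
  disp_le k h c -> disp_le l h d.
Proof.
move=> lk cd hc i j t jl tI; apply: le_trans cd.
by apply: hc => //; exact: leq_trans lk.
Qed.

Lemma disp_le0 k : disp_le k 0 0.
Proof. by move=> i j t jk tI; rewrite D_disp0// normr0. Qed.

Lemma derivable_continuous (f : R -> R) :
  (forall x, I01 x -> derivable_in I01 f x) -> {within I01, continuous f}.
Proof.
move=> df; apply/subspace_continuousP => x Ix; apply/cvgrPdist_lt => e e0.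
have FF := within_proper Ix; set l := derive_in I01 f x.
have : (fun y => (f y - f x) / (y - x)) @ within I01 x^' --> l := df x Ix.
move=> /cvgrPdist_lt /(_ 1 ltr01)/nbhs_ballP[d /= d0 dP].
have l1 : 0 < `|l| + 1 by rewrite ltr_wpDl.
apply/nbhs_ballP; exists (Num.min d (e / (`|l| + 1))) => /=.
  by rewrite lt_min d0 divr_gt0.
move=> y; rewrite /ball/= lt_min => /andP[yd ye] Iy.
have [->|yx] := eqVneq y x; first by rewrite subrr normr0.
have /= lq := dP y yd yx Iy.
have yx0 : y - x != 0 by rewrite subr_eq0.
rewrite distrC -(divfK yx0 (f y - f x)) normrM.
rewrite (distrC y x) (@le_lt_trans _ _ ((`|l| + 1) * `|x - y|))//.
  rewrite ler_wpM2r// -lerBlDl (le_trans _ (ltW lq))//.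
  by rewrite distrC (le_trans _ (lerB_dist _ _)).
by rewrite mulrC -ltr_pdivlMr.
Qed.

Lemma disp_bounded k (h : disp) : exists2 c, 0 <= c & disp_le k h c.
Proof.
have H1 (ij : 'I_n * 'I_k.+1) : exists c, 0 <= c /\
    forall t : R, t \in `[0, 1] -> `|D ij.2 (h ij.1) t| <= c.
  have ct : {within I01, continuous (D ij.2 (h ij.1))}.
    by apply: derivable_continuous => x Ix; exact: disp_smooth.
  have [c cI cP] := EVT_max (@ler01 R) ct.
  have [d dI dP] := EVT_min (@ler01 R) ct.
  exists (`|D ij.2 (h ij.1) c| + `|D ij.2 (h ij.1) d|).
  split=> [|t tI]; first by rewrite addr_ge0.
  have [t0|t0] := leP 0 (D ij.2 (h ij.1) t).
    by rewrite ger0_norm// (le_trans (cP t tI))// (le_trans (ler_norm _))// lerDl.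
  rewrite ltr0_norm// (@le_trans _ _ (- D ij.2 (h ij.1) d))// ?lerN2 ?dP//.
  rewrite -[X in _ <= _ + X]normrN (le_trans (ler_norm _))//.
  by rewrite lerDr.
have [c cP] := choice H1.
exists (\sum_ij c ij); first by apply: sumr_ge0 => ij _; have [] := cP ij.
move=> i j t jk tI; have jk1 : (j < k.+1)%N by [].
rewrite (le_trans ((cP (i, Ordinal jk1)).2 t tI))//.
rewrite (bigD1 (i, Ordinal jk1))//= lerDl sumr_ge0// => ij _.
by have [] := cP ij.
Qed.

Definition dball k (f : disp) (e : R) : set disp :=
  [set g | exists2 d, 0 <= d < e & disp_le k (g - f) d].

Lemma dball_open k f e : open (dball k f e).
Proof.
move=> g [d /andP[d0 de] gf]; have ed0 : 0 < (e - d) / 2.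
  by rewrite divr_gt0// subr_gt0.
exists k, ((e - d) / 2) => // h hg; exists ((e - d) / 2 + d); last first.
  by rewrite -(subrKA g); exact: disp_leD.
rewrite addr_ge0 ?(ltW ed0)//= -ltrBrDr ltr_pdivrMr// ltr_pMr ?subr_gt0//.
by rewrite ltr1n.
Qed.

Lemma nbhs_disp (f : disp) (A : set disp) : nbhs f A <->
  exists k, exists2 e, 0 < e & dball k f e `<=` A.
Proof.
split.
  case=> U [oU Uf UA]; have [k [e e0 H]] := oU _ Uf.
  exists k, e => // g [d /andP[d0 de] gd]; apply: UA; apply: H.
  by apply: disp_leW gd => //; exact: ltW.
case=> k [e e0 bA]; exists (dball k f e); split => //; first exact: dball_open.
by exists 0; rewrite ?lexx ?e0// subrr; exact: disp_le0.
Qed.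

Lemma disp_add_continuous : continuous (fun x : disp * disp => x.1 + x.2).
Proof.
move=> [f g] A /nbhs_disp[k [e e0 bA]].
exists (dball k f (e / 2), dball k g (e / 2)).
  by split; apply/nbhs_disp; exists k, (e / 2); rewrite ?divr_gt0.
move=> [f' g'] /= [[c /andP[c0 ce] cf] [d /andP[d0 de] dg]]; apply: bA.
exists (c + d); first by rewrite addr_ge0//= (splitr e) ltrD.
by rewrite opprD addrACA; exact: disp_leD.
Qed.

Lemma disp_scale_continuous : continuous (fun z : R^o * disp => z.1 *: z.2).
Proof.
move=> [a f] A /nbhs_disp[k [e e0 bA]].
have [c c0 fc] := disp_bounded k f.
have m0 : 0 < `|a| + 1 by rewrite ltr_wpDl.
have c1 : 0 < c + 1 by rewrite ltr_wpDl.
pose d := Num.min 1 (e / 2 / (c + 1)).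
exists (ball (a : R^o) d, dball k f (e / 2 / (`|a| + 1))).
  split; last first.
    by apply/nbhs_disp; exists k, (e / 2 / (`|a| + 1)); rewrite ?divr_gt0.
  by apply/nbhs_ballP; exists d => //=; rewrite lt_min ltr01 !divr_gt0.
move=> [a' f'] /= [+ [q /andP[q0 qe] qf]].
rewrite /ball/= lt_min => /andP[a1 ae].
apply: bA; exists ((`|a| + 1) * q + `|a' - a| * c).
  rewrite addr_ge0 ?mulr_ge0 ?(ltW m0)//= (splitr e) ltr_leD//.
    by rewrite mulrC -ltr_pdivlMr.
  rewrite (@le_trans _ _ (`|a' - a| * (c + 1))) ?ler_wpM2l ?lerDl//.
  by rewrite -ler_pdivlMr// distrC ltW.
rewrite (_ : _ - _ = a' *: (f' - f) + (a' - a) *: f); last first.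
  by rewrite scalerBr scalerBl subrKA.
apply: disp_leD; last exact: disp_leZ.
apply: disp_leW (disp_leZ a' qf) => //; rewrite ler_wpM2r//.
by rewrite -lerBlDl (le_trans (lerB_dist _ _))// distrC ltW.
Qed.

Lemma disp_locally_convex : exists2 C : set_system disp,
  (forall b, b \in C -> convex_set b) & basis C.
Proof.
exists [set b | exists k f e, b = dball k f e].
  move=> _ /set_mem[k [f [e ->]]] x y l.
  move=> /set_mem[c /andP[c0 ce] xc] /set_mem[d /andP[d0 de] yd].
  apply/mem_set; exists (Num.max c d).
    by rewrite le_max c0 gt_max ce.
  have l0 : 0 <= l%:num by [].
  have l1 : 0 <= 1 - l%:num by rewrite subr_ge0.
  rewrite (_ : _ - f = l%:num *: ((x : disp) - f) +
      (1 - l%:num) *: ((y : disp) - f)); last first.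
    rewrite !scalerBr addrACA -opprD -scalerDl.
    by rewrite (addrC l%:num) subrK scale1r.
  have -> : Num.max c d = `|l%:num| * Num.max c d + `|1 - l%:num| * Num.max c d.
    by rewrite !ger0_norm// -mulrDl addrC subrK mul1r.
  by apply: disp_leD; apply: disp_leZ;
    [apply: disp_leW xc|apply: disp_leW yd]; rewrite // le_max lexx ?orbT.
split.
  by move=> _ [k [f [e ->]]]; exact: dball_open.
move=> f A /nbhs_disp[k [e e0 bA]]; exists (dball k f e) => //; split.
  by exists k, f, e.
by exists 0; rewrite ?lexx ?e0// subrr; exact: disp_le0.
Qed.

(* [PreTopologicalLmod_isTvs] only provides the uniform structure. *)
HB.instance Definition _ := PreTopologicalLmod_isTvs.Build R disp
  disp_add_continuous disp_scale_continuous disp_locally_convex.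
HB.instance Definition _ :=
  PreTopologicalNmodule_isTopologicalNmodule.Build disp disp_add_continuous.
HB.instance Definition _ :=
  TopologicalNmodule_isTopologicalLmodule.Build R disp disp_scale_continuous.
HB.instance Definition _ :=
  Uniform_isTvs.Build R disp disp_locally_convex.

End Displacements.

Section Smooth_structure.
Context (R : realType) (n : nat).

(* [(x, y, h)] stands for lifts to R^n of the source and of the target, and the
   reparametrized restrictions [t |-> t + h_i t]. As R^n -> (S^1)^n is a
   covering, a function on BDiff is smooth iff it is so in these coordinates. *)
Definition coords : Type := ('rV[R]_n * 'rV[R]_n * disp R n)%type.

Definition row_conf (x : 'rV[R]_n) : config R n := fun i => toS1 (x 0 i).

Definition coords_dom : set coords := [set c : coords |
  [/\ Bconf (row_conf c.1.1), Bconf (row_conf c.1.2) &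
      forall i, diffeo_on 0 1 (fun t => t + c.2 i t)]].

Definition has_coords (a : arrow R n) (c : coords) : Prop :=
  [/\ src a = row_conf c.1.1, trg a = row_conf c.1.2 &
      forall i (t : R), t \in `[0, 1] ->
        a.2 (arc_pt (src a i) (src a (ordS i)) t) =
        arc_pt (trg a i) (trg a (ordS i)) (t + c.2 i t)].

Definition smooth_on_BDiff (f : arrow R n -> 'rV[R]_n) : Prop :=
  exists2 g : coords -> 'rV[R]_n, Coo_on coords_dom g &
    forall a c, BDiff a -> coords_dom c -> has_coords a c -> f a = g c.

Definition coboundary (c : arrow R n -> arrow R n -> 'rV[R]_n) : Prop :=
  exists2 f : arrow R n -> 'rV[R]_n, smooth_on_BDiff f &
    forall phi psi, BDiff phi -> BDiff psi -> src phi = trg psi ->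
      c phi psi = f phi + f psi - f (bcomp phi psi).

End Smooth_structure.

(* Main.v *)
Require Import Defs.
From mathcomp Require Import all_boot all_order all_algebra.
From mathcomp Require Import all_classical all_reals all_analysis.
From HB Require Import structures.
From mathcomp Require Import measurable_realfun ring lra.

Set Implicit Arguments.
Unset Strict Implicit.
Unset Printing Implicit Defensive.
Import Order.TTheory GRing.Theory Num.Theory.
Import numFieldNormedType.Exports.
Local Open Scope classical_set_scope.
Local Open Scope ring_scope.

(** The identity behind the cocycle is the chain rule
      log (phi o psi)_x = log phi_x o psi + log psi_x.
    Over one arc, with lifts F, G, H of phi, psi, eta, put
      I(F, G) = int log F'(G) d log G'.
    Expanding log (G o H)' and log (F o G)' turns the identity
      I(F, G o H) + I(G, H) = I(F o G, H) + I(F, G)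
    into one change of variables by H ([log_int_cocycle]). Since I vanishes as
    soon as one of its arguments is a translation, the same identity shows that
    I does not depend on the chosen lifts of the maps and of the arcs
    ([chi_lift]); this gives the cocycle identity for [chi]
    ([chi_cocycle]) and [chi = 0] on units, hence the groupoid structure on the
    extension ([extension_groupoid]).

    For nontriviality, let P_X(x) = x + e X(x), where X is a polynomial
    vanishing at 0 and 1; repeating P_X on each of n equal arcs gives an element
    of the isotropy group at the regular configuration. Expanding in e,
      chi(P_X, P_Y) - chi(P_Y, P_X)
        = e^2 (int X' Y'' - int Y' X'') + O(e^3)
    ([chi_expansion]). If [chi] is the coboundary of f, then the left-hand side
    is f(P_Y P_X) - f(P_X P_Y), and
      P_Y P_X - P_X P_Y = e^2 (X Y' - Y X') + O(e^3).
    As f is C^1 in the coordinates, the mean value theorem along the segment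
    that joins the two displacements, divided by e^2, gives in the limit
      df(id; X Y' - Y X') = int X' Y'' - int Y' X''
    ([coboundary_bracket]). All compositions are polynomial in x and e, so they
    stay in finite-dimensional families of displacements and no estimate on
    higher derivatives is needed. The left-hand side depends only on the
    bracket X Y' - Y X', but with a = x - x^2 the pairs (10 a, a x^3) and
    (30 a x, a x^2) have the same bracket 30 a^2 x^2 while the right-hand sides
    are 10 and 12 ([chi_not_coboundary]). *)

(** * Derivatives relative to a set *)

Section Derivative_in.
Context {R : realType}.
Implicit Types (A B : set R) (f g h q : R -> R) (a b c d x y l m : R).

(** [f] has derivative [l] at [x] relative to [A]. *)
Definition is_der_in A f x l : Prop := diff_quot_in A f x --> l.

(** Caratheodory's form of differentiability: the difference quotient extends
    continuously to [x]. It makes the chain, product and inverse function rules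
    pointwise identities followed by a limit. *)
Lemma is_der_inP A f x l : is_der_in A f x l <->
  exists q, [/\ forall y, A y -> f y - f x = q y * (y - x), q x = l &
    q @ within A (nbhs x) --> q x].
Proof.
rewrite /is_der_in /diff_quot_in; split=> [fl|[q [fq qx qc]]].
  pose q y := if y == x then l else (f y - f x) / (y - x).
  exists q; split; rewrite /q ?eqxx//.
    move=> y _; case: eqVneq => [->|yx]; first by rewrite !subrr mulr0.
    by rewrite divfK// subr_eq0.
  apply/cvgrPdist_lt => e e0; move/cvgrPdist_lt: fl => /(_ e e0).
  move=> H; change (nbhs x (fun y => A y -> `|l - q y| < e)).
  apply: filterS (H : nbhs x (fun y => y != x -> A y -> _)) => y Hy Ay.
  by rewrite /q; case: eqVneq => [_|yx]; [rewrite subrr normr0|exact: Hy].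
apply/cvgrPdist_lt => e e0; move/cvgrPdist_lt: qc => /(_ e e0) H.
change (nbhs x (fun y => y != x -> A y -> `|l - (f y - f x) / (y - x)| < e)).
apply: filterS (H : nbhs x (fun y => A y -> `|q x - q y| < e)) => y Hy yx Ay.
by rewrite fq// mulfK ?subr_eq0// -qx Hy.
Qed.

Lemma cvg_within_eq A f g x l : (forall y, A y -> f y = g y) ->
  f @ within A (nbhs x) --> l -> g @ within A (nbhs x) --> l.
Proof.
move=> fg fl P HP; have fP : nbhs x (fun y => A y -> P (f y)) := fl P HP.
change (nbhs x (fun y => A y -> P (g y))).
by apply: filterS fP => y Py Ay; rewrite -fg//; exact: Py.
Qed.

Lemma is_der_in_eq A f g x l : {in A, f =1 g} -> A x ->
  is_der_in A f x l -> is_der_in A g x l.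
Proof.
move=> fg Ax /is_der_inP[q [fq qx qc]]; apply/is_der_inP; exists q; split => //.
by move=> y Ay; rewrite -!fg ?inE//; exact: fq.
Qed.

Lemma is_der_in_sub A B f x l : A `<=` B ->
  is_der_in B f x l -> is_der_in A f x l.
Proof.
move=> AB /is_der_inP[q [fq qx qc]]; apply/is_der_inP; exists q; split => //.
  by move=> y Ay; apply: fq; apply: AB.
apply: cvg_trans qc; apply: cvg_app.
by apply: within_subset => //; exact: nbhs_filter.
Qed.

Lemma is_der_in_continuous A f x l : is_der_in A f x l ->
  f @ within A (nbhs x) --> f x.
Proof.
move=> /is_der_inP[q [fq qx qc]].
have c1 : (fun y => y - x) @ within A (nbhs x) --> x - x.
  by apply: cvgB; [exact: cvg_within|exact: cvg_cst].
have fc : (fun y => q y * (y - x) + f x) @ within A (nbhs x) -->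
    q x * (x - x) + f x.
  by apply: cvgD; [exact: cvgM|exact: cvg_cst].
rewrite subrr mulr0 add0r in fc; apply: cvg_within_eq fc => y Ay.
by rewrite -fq// subrK.
Qed.

Lemma is_der_in_comp A B f g x l m : (forall y, A y -> B (g y)) -> A x ->
  is_der_in B f (g x) l -> is_der_in A g x m ->
  is_der_in A (f \o g) x (l * m).
Proof.
move=> AB Ax /is_der_inP[q [fq qx qc]] gm.
have gc := is_der_in_continuous gm.
move/is_der_inP: gm => [r [gr rx rc]].
apply/is_der_inP; exists (fun y => q (g y) * r y); split; rewrite ?qx ?rx//.
  move=> y Ay; rewrite -[LHS]/(f (g y) - f (g x)) (fq (g y)); last exact: AB.
  by rewrite gr// mulrA.
rewrite -rx -qx; apply: (@cvgM _ _ (within A (nbhs x))) => //.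
apply: cvg_comp qc => P; rewrite !nbhs_simpl => HP.
have := gc _ HP => H; change (nbhs x (fun y => A y -> P (g y))).
apply: filterS (H : nbhs x (fun y => A y -> B (g y) -> P (g y))) => y Hy Ay.
by apply: Hy => //; exact: AB.
Qed.

Lemma is_der_inM A f g x l m : is_der_in A f x l -> is_der_in A g x m ->
  is_der_in A (f * g) x (l * g x + f x * m).
Proof.
move=> fl gm; have gc := is_der_in_continuous gm.
move/is_der_inP: fl => [q [fq qx qc]]; move/is_der_inP: gm => [r [gr rx rc]].
apply/is_der_inP; exists (fun y => q y * g y + f x * r y).
split; rewrite ?qx ?rx//.
  move=> y Ay; rewrite -[LHS]/(f y * g y - f x * g x) mulrDl mulrAC -fq//.
  by rewrite -(mulrA (f x)) -gr//; ring.
rewrite -qx -rx; apply: cvgD; first exact: cvgM.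
by apply: cvgM => //; exact: cvg_cst.
Qed.

Lemma is_der_inD A f g x l m : is_der_in A f x l -> is_der_in A g x m ->
  is_der_in A (f + g) x (l + m).
Proof.
move=> /is_der_inP[q [fq qx qc]] /is_der_inP[r [gr rx rc]].
apply/is_der_inP; exists (q + r); split; rewrite -?qx -?rx//.
  move=> y Ay; rewrite -[LHS]/(f y + g y - (f x + g x)).
  by rewrite -[_ * _]/((q y + r y) * _) mulrDl -fq// -gr//; ring.
exact: cvgD.
Qed.

Lemma is_der_in_cst A (c : R) x : is_der_in A (fun=> c) x 0.
Proof.
by apply/is_der_inP; exists 0; split => [y _||]; rewrite ?subrr ?mul0r//;
  exact: cvg_cst.
Qed.

Lemma is_der_in_id A x : is_der_in A id x 1.
Proof.
by apply/is_der_inP; exists (fun=> 1); split => [y _||]; rewrite ?mul1r//;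
  exact: cvg_cst.
Qed.

Lemma is_derive_in A f x l : is_derive x 1 f l -> is_der_in A f x l.
Proof.
move=> [df dl]; apply: (@is_der_in_sub _ setT) => //.
have : (fun k : R => k^-1 *: ((f \o shift x) (k *: (1 : R)) - f x)) @ 0^' --> l.
  by rewrite -dl; exact: df.
move=> fl; apply/cvgrPdist_lt => e e0; move/cvgrPdist_lt: fl => /(_ e e0).
move=> /nbhs_ballP[d /= d0 dP].
apply/nbhs_ballP; exists d => //= y; rewrite /ball/= => yd yx _.
have := dP (y - x); rewrite /ball/= sub0r normrN distrC subr_eq0.
move=> /(_ yd yx); rewrite /shift/= [_ *: 1]mulr1 subrK.
by rewrite [_ *: _]mulrC.
Qed.

Lemma is_der_in_is_derive a b f x l : x \in `]a, b[ ->
  is_der_in `[a, b] f x l -> is_derive x (1 : R) f l.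
Proof.
move=> xab fl; suff H : (fun k : R =>
    k^-1 *: ((f \o shift x) (k *: (1 : R)) - f x)) @ 0^' --> l.
  apply: DeriveDef; first by apply/cvg_ex; exists l; exact: H.
  by apply: cvg_lim => //; exact: H.
apply/cvgrPdist_lt => e e0; move/cvgrPdist_lt: fl => /(_ e e0).
move=> /nbhs_ballP[d /= d0 dP].
have /nbhs_ballP[d' /= d'0 d'P] : nbhs x (`]a, b[%classic : set R).
  by apply: open_nbhs_nbhs; split => //; exact: interval_open.
apply/nbhs_ballP; exists (Num.min d d') => /=; first by rewrite lt_min d0.
move=> y; rewrite /ball/= sub0r normrN lt_min => /andP[yd yd'] y0.
have yx : `|x - (y + x)| = `|y| by rewrite opprD addrCA subrr addr0 normrN.
have := dP (y + x); rewrite /ball/= yx => /(_ yd).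
rewrite -subr_eq0 addrK => /(_ y0).
have : `]a, b[%classic (y + x) by apply: d'P; rewrite /ball/= yx.
move=> /subset_itv_oo_cc yab /(_ yab).
by rewrite /shift/= [_ *: 1]mulr1 [_ *: _]mulrC.
Qed.

(** Derivative of an inverse function, given its continuity. *)
Lemma is_der_in_inv_fun A f g x l : (forall y, A y -> g (f y) = y) ->
  A x -> is_der_in A f x l -> l != 0 ->
  g @ within (f @` A) (nbhs (f x)) --> g (f x) ->
  is_der_in (f @` A) g (f x) l^-1.
Proof.
move=> gf Ax /is_der_inP[q [fq qx qc]] l0 gc.
apply/is_der_inP; exists (fun z => (q (g z))^-1); split; rewrite ?gf ?qx//.
  move=> _ [y Ay <-]; rewrite !gf//; case: (eqVneq y x) => [->|yx].
    by rewrite !subrr mulr0.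
  have : f y - f x != 0.
    rewrite subr_eq0; apply: contra yx => /eqP fyx.
    by rewrite -(gf y)// fyx gf.
  by rewrite fq// mulf_eq0 negb_or => /andP[q0 _]; rewrite mulrA mulVf// mul1r.
apply: cvgV => //.
suff H : (fun z => q (g z)) @ within (f @` A) (nbhs (f x)) --> q x.
  by rewrite -qx.
apply: (cvg_comp _ _ _ qc) => P HP.
have HP' : nbhs (g (f x)) (fun y => A y -> P y) by rewrite gf.
have H : nbhs (f x) (fun z => (f @` A) z -> A (g z) -> P (g z)) := gc _ HP'.
change (nbhs (f x) (fun z => (f @` A) z -> P (g z))).
apply: filterS H => z Hz Az; apply: (Hz Az).
by case: Az => y Ay <-; rewrite gf.
Qed.

End Derivative_in.

(** * Smooth functions on a segment *)

Section Smooth_on_segment.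
Context {R : realType}.
Implicit Types (f g h : R -> R) (a b c d x y l m : R).

Lemma within_itv_proper a b x : a < b -> `[a, b]%classic x ->
  ProperFilter (within `[a, b] x^').
Proof.
move=> ab; rewrite /= in_itv/= => /andP[ax xb]; apply: Build_ProperFilter_ex.
move=> P /nbhs_ballP[e /= e0 He].
pose r := Num.min (e / 2) ((b - a) / 2).
have r0 : 0 < r by rewrite lt_min !divr_gt0// subr_gt0.
have re : r < e by rewrite gt_min ltr_pdivrMr// ltr_pMr// ltr1n.
have rab : r <= (b - a) / 2 by rewrite ge_min lexx orbT.
have [xh|xh] := leP x ((a + b) / 2).
- exists (x + r); apply: He => /=.
  + by rewrite /ball/= opprD addNKr normrN gtr0_norm.
  + by rewrite -subr_eq0 addrAC subrr add0r gt_eqF.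
  + by rewrite in_itv/=; apply/andP; split; lra.
- exists (x - r); apply: He => /=.
  + by rewrite /ball/= opprB addrC subrK gtr0_norm.
  + by rewrite -subr_eq0 addrAC subrr add0r oppr_eq0 gt_eqF.
  + by rewrite in_itv/=; apply/andP; split; lra.
Qed.

(** On a nondegenerate segment the relative derivative is unique. *)
Lemma derive_in_val a b f x l : a < b -> `[a, b]%classic x ->
  is_der_in `[a, b] f x l -> derive_in `[a, b] f x = l.
Proof.
move=> ab xab fl; have FF := within_itv_proper ab xab.
by apply: cvg_lim => //; exact: fl.
Qed.

Lemma is_der_in_derivable A f x l : is_der_in A f x l -> derivable_in A f x.
Proof. by move=> fl; apply/cvg_ex; exists l. Qed.

Lemma derivable_is_der_in A f x : derivable_in A f x ->
  is_der_in A f x (derive_in A f x).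
Proof. by []. Qed.

Lemma eq_diff_quot_in (A : set R) f g x : {in A, f =1 g} -> A x ->
  diff_quot_in A f x = diff_quot_in A g x.
Proof.
move=> fg Ax; rewrite /diff_quot_in; apply/funext => P; apply/propext.
suff H f' g' : {in A, f' =1 g'} ->
    ((fun y => (f' y - f' x) / (y - x)) @ within A x^') P ->
    ((fun y => (g' y - g' x) / (y - x)) @ within A x^') P.
  by split; apply: H => // y yA; rewrite fg.
move=> fg' H; change (nbhs x^' (fun y => A y -> P ((g' y - g' x) / (y - x)))).
apply: filterS (H : nbhs x^' (fun y => A y -> P ((f' y - f' x) / (y - x)))).
by move=> y Py yA; rewrite -!fg' ?inE//; exact: Py.
Qed.

Lemma eq_derive_in_n (A : set R) f g k : {in A, f =1 g} ->
  {in A, derive_in_n A k f =1 derive_in_n A k g}.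
Proof.
move=> fg; elim: k => [|k IH]//= x /[!inE] xA.
by rewrite /derive_in (eq_diff_quot_in IH).
Qed.

(** [f] is [k] times differentiable on [A]. A [Variant] rather than a bare
    quantified formula, so that unification does not unfold it down to the
    limits that define [derive_in]. *)
Variant Ck_in (A : set R) (k : nat) f : Prop := CkIn of
  forall j x, (j < k)%N -> A x -> derivable_in A (derive_in_n A j f) x.

Lemma smooth_inP (A : set R) f : smooth_in A f <-> forall k, Ck_in A k f.
Proof.
split=> [fs k|fs j x Ax]; first by split=> j x _; exact: fs.
by have [H] := fs j.+1; exact: H.
Qed.

Lemma eq_Ck_in (A : set R) k f g : {in A, f =1 g} -> Ck_in A k f -> Ck_in A k g.
Proof.
move=> fg [fk]; split=> j x jk Ax; rewrite /derivable_in.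
by rewrite -(eq_diff_quot_in (eq_derive_in_n j fg) Ax); exact: fk.
Qed.

Lemma eq_smooth_in (A : set R) f g : {in A, f =1 g} ->
  smooth_in A f -> smooth_in A g.
Proof.
by move=> fg /smooth_inP fs; apply/smooth_inP => k; exact: eq_Ck_in (fs k).
Qed.

Lemma Ck_in_der (A : set R) k f x : Ck_in A k.+1 f -> A x ->
  is_der_in A f x (derive_in A f x).
Proof. by move=> [fk] Ax; apply/derivable_is_der_in; exact: (fk 0%N). Qed.

Lemma Ck_in_derive (A : set R) k f :
  Ck_in A k.+1 f -> Ck_in A k (derive_in A f).
Proof.
move=> [fk]; split=> j x jk Ax.
by have := fk j.+1 x jk Ax; rewrite /derive_in_n iterSr.
Qed.

Lemma Ck_inW (A : set R) k f : Ck_in A k.+1 f -> Ck_in A k f.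
Proof. by move=> [fk]; split=> j x jk; apply: fk; exact: ltnW. Qed.

Lemma smooth_in_der (A : set R) f x : smooth_in A f -> A x ->
  is_der_in A f x (derive_in A f x).
Proof. by move=> /smooth_inP/(_ 1%N)/Ck_in_der; exact. Qed.

Lemma smooth_in_derive (A : set R) f :
  smooth_in A f -> smooth_in A (derive_in A f).
Proof.
by move=> /smooth_inP fs; apply/smooth_inP => k; exact: Ck_in_derive.
Qed.

Lemma is_der_in_within_continuous (A : set R) f f' :
  (forall x, A x -> is_der_in A f x (f' x)) -> {within A, continuous f}.
Proof.
move=> ff'; apply/subspace_continuousP => x Ax.
exact: is_der_in_continuous (ff' x Ax).
Qed.

Lemma smooth_in_continuous (A : set R) f : smooth_in A f ->
  {within A, continuous f}.
Proof.
move=> fs; apply: is_der_in_within_continuous => x Ax; exact: smooth_in_der Ax.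
Qed.

Section Ck_segment.
Variables (a b : R) (ab : a < b).
Local Notation A := (`[a, b]%classic : set R).

(** The induction step of every closure property below: it suffices to know a
    derivative of [f] that is of class one less. *)
Lemma Ck_inS k f f' : (forall x, A x -> is_der_in A f x (f' x)) ->
  Ck_in A k f' -> Ck_in A k.+1 f.
Proof.
move=> ff' f'k; split=> -[|j] x jk Ax.
  exact: is_der_in_derivable (ff' _ Ax).
rewrite /derive_in_n iterSr.
have ff'E : {in A, f' =1 derive_in A f}.
  by move=> y /[!inE] Ay; rewrite (derive_in_val ab Ay (ff' _ Ay)).
by have [H] := eq_Ck_in ff'E f'k; exact: H.
Qed.

Lemma Ck_in_cst k (c : R) : Ck_in A k (fun=> c).
Proof.
elim: k c => [|k IH] c; first by split.
by apply: Ck_inS (IH 0) => x Ax; exact: is_der_in_cst.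
Qed.

Lemma Ck_in_id k : Ck_in A k id.
Proof.
case: k => [|k]; first by split.
apply: (@Ck_inS k id (fun=> 1)) => [x Ax|]; first exact: is_der_in_id.
exact: Ck_in_cst.
Qed.

Lemma Ck_inD k f g : Ck_in A k f -> Ck_in A k g -> Ck_in A k (f + g).
Proof.
elim: k f g => [|k IH] f g fk gk; first by split.
apply: (@Ck_inS _ _ (derive_in A f + derive_in A g)) => [x Ax|].
  by apply: is_der_inD; [exact: Ck_in_der fk Ax|exact: Ck_in_der gk Ax].
by apply: IH; exact: Ck_in_derive.
Qed.

Lemma Ck_inM k f g : Ck_in A k f -> Ck_in A k g -> Ck_in A k (f * g).
Proof.
elim: k f g => [|k IH] f g fk gk; first by split.
apply: (@Ck_inS _ _ (derive_in A f * g + f * derive_in A g)) => [x Ax|].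
  by apply: is_der_inM; [exact: Ck_in_der fk Ax|exact: Ck_in_der gk Ax].
have [f'k g'k] := (Ck_in_derive fk, Ck_in_derive gk).
exact: (Ck_inD (IH _ _ f'k (Ck_inW gk)) (IH _ _ (Ck_inW fk) g'k)).
Qed.

Lemma Ck_in_comp k (B : set R) f g : (forall x, A x -> B (g x)) ->
  Ck_in B k f -> Ck_in A k g -> Ck_in A k (f \o g).
Proof.
move=> gB; elim: k f => [|k IH] f fk gk; first by split.
apply: (@Ck_inS _ _ ((derive_in B f \o g) * derive_in A g)) => [x Ax|].
  apply: (@is_der_in_comp _ _ B) => //; last exact: Ck_in_der gk Ax.
  exact: Ck_in_der fk (gB x Ax).
have g'k := Ck_in_derive gk; have f'k := Ck_in_derive fk.
exact: (Ck_inM (IH _ f'k (Ck_inW gk)) g'k).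
Qed.

End Ck_segment.

Lemma is_der_in_invr (A : set R) x : x != 0 ->
  is_der_in A (fun y => y^-1) x (- (x^-1 * x^-1)).
Proof.
move=> x0; have <- : - x ^- 2 *: 1 = - (x^-1 * x^-1).
  by rewrite [LHS]mulr1 -expr2 exprVn.
apply: is_derive_in.
exact: (@is_deriveV _ id x 1 1 x0 (is_derive_id _ _)).
Qed.

Lemma is_der_in_ln (A : set R) x : 0 < x -> is_der_in A (@ln R) x x^-1.
Proof. by move=> x0; apply: is_derive_in; exact: is_derive1_ln. Qed.

Lemma is_der_inV (B : set R) f x l : B x -> f x != 0 -> is_der_in B f x l ->
  is_der_in B (fun y => (f y)^-1) x (- ((f x)^-1 * (f x)^-1) * l).
Proof.
move=> Bx fx0 fl; apply: (@is_der_in_comp _ B setT (fun y => y^-1) f) => //.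
exact: is_der_in_invr.
Qed.

Lemma is_der_in_lnf (B : set R) f x l : B x -> 0 < f x -> is_der_in B f x l ->
  is_der_in B (fun y => ln (f y)) x ((f x)^-1 * l).
Proof.
move=> Bx fx0 fl; apply: (@is_der_in_comp _ B setT (@ln R) f) => //.
exact: is_der_in_ln.
Qed.

Lemma is_der_in_horner (B : set R) (p : {poly R}) x :
  is_der_in B (fun x => p.[x]) x p^`().[x].
Proof. by apply: is_derive_in; exact: is_derive_poly. Qed.

Section Smooth_segment.
Variables (a b : R) (ab : a < b).
Local Notation A := (`[a, b]%classic : set R).

Lemma Ck_inV k f : (forall x, A x -> f x != 0) -> Ck_in A k f ->
  Ck_in A k (fun x => (f x)^-1).
Proof.
move=> f0; elim: k => [|k IH] fk; first by split.
have fVk := IH (Ck_inW fk).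
apply: (@Ck_inS _ _ ab _ _ ((fun=> -1) * ((fun x => (f x)^-1) *
    (fun x => (f x)^-1)) * derive_in A f)) => [x Ax|].
  rewrite [X in is_der_in _ _ _ X](_ : _ =
    - ((f x)^-1 * (f x)^-1) * derive_in A f x).
    exact: is_der_inV Ax (f0 _ Ax) (Ck_in_der fk Ax).
  by rewrite -[in RHS]mulN1r.
have f'k := Ck_in_derive fk.
exact: (Ck_inM ab (Ck_inM ab (Ck_in_cst ab k (-1)) (Ck_inM ab fVk fVk)) f'k).
Qed.

Lemma Ck_in_ln k f : (forall x, A x -> 0 < f x) -> Ck_in A k f ->
  Ck_in A k (fun x => ln (f x)).
Proof.
case: k => [|k] f0 fk; first by split.
apply: (@Ck_inS _ _ ab _ _ ((fun x => (f x)^-1) * derive_in A f)) => [x Ax|].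
  exact: is_der_in_lnf Ax (f0 _ Ax) (Ck_in_der fk Ax).
have f'k := Ck_in_derive fk.
have fV : forall x, A x -> f x != 0 by move=> x Ax; rewrite gt_eqF// f0.
exact: (Ck_inM ab (Ck_inV fV (Ck_inW fk)) f'k).
Qed.

Lemma smooth_in_comp (B : set R) f g : (forall x, A x -> B (g x)) ->
  smooth_in B f -> smooth_in A g -> smooth_in A (f \o g).
Proof.
move=> AB /smooth_inP fs /smooth_inP gs; apply/smooth_inP => k.
exact: (Ck_in_comp ab AB (fs k) (gs k)).
Qed.

Lemma smooth_in_ln f : (forall x, A x -> 0 < f x) -> smooth_in A f ->
  smooth_in A (fun x => ln (f x)).
Proof.
by move=> f0 /smooth_inP fs; apply/smooth_inP => k; exact: Ck_in_ln.
Qed.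

Lemma smooth_in_affine (c d : R) : smooth_in A (fun x => c * x + d).
Proof.
apply/smooth_inP => k; apply: (Ck_inD ab) (Ck_in_cst ab _ _).
by apply: (Ck_inM ab) (Ck_in_id ab _); exact: Ck_in_cst.
Qed.

Lemma smooth_in_horner (p : {poly R}) : smooth_in A (fun x => p.[x]).
Proof.
apply/smooth_inP => k; elim/poly_ind: p => [|p c IH].
  by apply: eq_Ck_in (Ck_in_cst ab k 0) => x _; rewrite horner0.
apply: eq_Ck_in (Ck_inD ab (Ck_inM ab IH (Ck_in_id ab k)) (Ck_in_cst ab k c)).
by move=> x _; rewrite hornerMXaddC.
Qed.

End Smooth_segment.

End Smooth_on_segment.

(** * Diffeomorphisms of segments and change of variables *)

Section Diffeomorphisms_of_segments.
Context {R : realType}.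
Implicit Types (f g h : R -> R) (a b c d x y l m : R).

(** A derivative is nonnegative when all difference quotients are. *)
Lemma within_punctured_ge (A : set R) f x l :
  ProperFilter (within A x^') -> (forall y, A y -> y != x ->
  0 <= (f y - f x) / (y - x)) -> is_der_in A f x l -> 0 <= l.
Proof.
move=> FF f0 fl; rewrite leNgt; apply/negP => l0.
move/cvgrPdist_lt : (fl) => /(_ (- l)); rewrite oppr_gt0 => /(_ l0) H.
have {}H : nbhs x (fun y => y != x -> A y ->
    `|l - (f y - f x) / (y - x)| < - l).
  exact: H.
have : within A x^' set0.
  change (nbhs x (fun y => y != x -> A y -> False)).
  apply: filterS H => y Hy yx Ay; have := Hy yx Ay; apply/negP; rewrite -leNgt.
  rewrite distrC (le_trans _ (ler_norm _))// lerBrDl subrr.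
  exact: f0.
exact: filter_not_empty.
Qed.

(** An increasing diffeomorphism has a positive derivative, by the chain rule
    applied to its smooth inverse. *)
Lemma diffeo_on_derive_gt0 a b f : a < b ->
  {in `[a, b] &, {homo f : x y / x < y}} -> diffeo_on a b f ->
  forall x, `[a, b]%classic x -> 0 < derive_in `[a, b] f x.
Proof.
move=> ab fincr [fs fab [g gs fg]] x xA.
have fl := smooth_in_der fs xA; set l := derive_in _ f x in fl *.
have FF := within_itv_proper ab xA.
rewrite lt_neqAle; apply/andP; split; last first.
  apply: within_punctured_ge FF _ fl => y Ay yx.
  case: (ltgtP y x) (yx) => // {}yx _.
    by rewrite nmulr_lge0 ?invr_lt0 ?subr_lt0// subr_le0 ltW// fincr.
  by rewrite pmulr_lge0 ?invr_gt0 ?subr_gt0// subr_ge0 ltW// fincr.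
apply/eqP => l0.
have fAB y : `[a, b]%classic y -> `[f a, f b]%classic (f y).
  by move=> Ay; rewrite -fab; exists y.
have : is_der_in `[a, b] (g \o f) x (derive_in `[f a, f b] g (f x) * l).
  apply: (is_der_in_comp fAB xA _ fl).
  by apply: smooth_in_der gs _; exact: fAB.
rewrite -l0 mulr0 => gf.
have : is_der_in `[a, b] id x 0.
  by apply: is_der_in_eq gf => // y /[!inE] Ay; exact: fg.
move=> /(derive_in_val ab xA) H.
have := derive_in_val ab xA (is_der_in_id `[a, b]%classic x).
by rewrite H => /eqP; rewrite eq_sym oner_eq0.
Qed.

(** The inverse [g] satisfies g' = (1 / f') o g, so its class of
    differentiability improves by one at each step. *)
Lemma inverse_smooth a b f g : a < b -> f a < f b -> smooth_in `[a, b] f ->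
  (forall x, `[a, b]%classic x -> derive_in `[a, b] f x != 0) ->
  f @` `[a, b] = `[f a, f b]%classic -> {in `[a, b], cancel f g} ->
  smooth_in `[f a, f b] g.
Proof.
move=> ab fafb fs f'0 fab fg.
set A := `[a, b]%classic; set B := `[_, _]%classic.
have gB y : B y -> A (g y).
  by rewrite /B -fab => -[x Ax <-]; rewrite fg.
have gc : {within B, continuous g}.
  exact: segment_can_le_continuous (ltW ab) (smooth_in_continuous fs) fg.
have gder y : B y -> is_der_in B g y (derive_in A f (g y))^-1.
  rewrite /B -fab => -[x Ax <-]; rewrite fg//.
  apply: is_der_in_inv_fun; rewrite ?f'0//.
  - exact: smooth_in_der.
  - rewrite fab; move/subspace_continuousP: gc; apply.
    by rewrite /B -fab; exists x.
apply/smooth_inP; elim => [|k IH]; first by split.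
apply: (@Ck_inS _ _ _ fafb _ _ ((fun x => (derive_in A f x)^-1) \o g)) => //.
apply: (Ck_in_comp fafb gB) => //; apply: Ck_inV => //.
by move: k {IH}; apply/smooth_inP; exact: smooth_in_derive.
Qed.

Lemma derive_gt0_homo a b f f' : (forall x, `[a, b]%classic x ->
  is_der_in `[a, b] f x (f' x) /\ 0 < f' x) ->
  {in `[a, b] &, {homo f : x y / x < y}}.
Proof.
move=> ff' x y xab yab xy.
have sub : (`[x, y]%classic : set R) `<=` `[a, b]%classic.
  move=> z; rewrite /= !in_itv/= => /andP[xz zy].
  move: xab yab; rewrite !in_itv/= => /andP[ax _] /andP[_ yb].
  by rewrite (le_trans ax xz) (le_trans zy yb).
have d z : `[x, y]%classic z -> is_der_in `[x, y] f z (f' z).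
  by move=> /sub/ff'[/(is_der_in_sub sub)].
have [z zxy|z zxy fE] := MVT xy (df := f') _ (is_der_in_within_continuous d).
  by apply: is_der_in_is_derive (zxy) _; apply: d; exact: subset_itv_oo_cc.
rewrite -subr_gt0 fE mulr_gt0// ?subr_gt0//.
by have [] := ff' z (sub _ (subset_itv_oo_cc zxy)).
Qed.

Lemma segment_image a b f : a < b -> {in `[a, b] &, {homo f : x y / x < y}} ->
  {within `[a, b], continuous f} -> f @` `[a, b] = `[f a, f b]%classic.
Proof.
move=> ab fincr fc; have aab : a \in `[a, b] by rewrite bound_itvE ltW.
have bab : b \in `[a, b] by rewrite bound_itvE ltW.
have fle x y : x \in `[a, b] -> y \in `[a, b] -> x <= y -> f x <= f y.
  by move=> xab yab; rewrite le_eqVlt => /predU1P[->//|xy]; rewrite ltW// fincr.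
apply/seteqP; split => [_ [x /= xab <-]|y /=].
  by rewrite in_itv/= !fle// (itvP xab).
rewrite in_itv/= => yfab; have fab : f a <= f b by rewrite fle// ltW.
have [|x xab xy] := IVT (ltW ab) fc (v := y); last by exists x.
by rewrite min_l// max_r.
Qed.

(** Conversely, a smooth function with positive derivative is a
    diffeomorphism onto its image. *)
Lemma diffeo_onI a b f : a < b -> smooth_in `[a, b] f ->
  (forall x, `[a, b]%classic x -> 0 < derive_in `[a, b] f x) -> diffeo_on a b f.
Proof.
move=> ab fs f0.
have fincr : {in `[a, b] &, {homo f : x y / x < y}}.
  apply: (@derive_gt0_homo _ _ _ (derive_in `[a, b] f)) => x Ax.
  by split; [exact: smooth_in_der|exact: f0].
have fafb : f a < f b by rewrite fincr// bound_itvE ltW.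
have fab := segment_image ab fincr (smooth_in_continuous fs).
pose g y := xget a [set x | `[a, b]%classic x /\ f x = y].
have fg : {in `[a, b], cancel f g}.
  move=> x xab; rewrite /g; case: xgetP => [z _ [zab fzx]|/(_ x)]; last first.
    by move=> /(_ (conj xab erefl)).
  case: (ltgtP z x) => // zx.
    by have := fincr _ _ zab xab zx; rewrite fzx ltxx.
  by have := fincr _ _ xab zab zx; rewrite fzx ltxx.
split => //; exists g => //; apply: inverse_smooth => // x Ax.
by rewrite gt_eqF// f0.
Qed.

Lemma eq_diffeo_on a b f g : a < b -> {in `[a, b], f =1 g} ->
  diffeo_on a b f -> diffeo_on a b g.
Proof.
move=> ab fg; have aab : a \in `[a, b] by rewrite bound_itvE ltW.
have bab : b \in `[a, b] by rewrite bound_itvE ltW.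
rewrite /diffeo_on -!fg// => -[fs fab [h hs fh]]; split.
- by apply: eq_smooth_in fs => x /[!inE]; exact: fg.
- rewrite -fab; apply/seteqP; split => _ [x xab <-]; exists x => //.
    exact: fg.
  by rewrite fg.
- by exists h => // x xab; rewrite -fg// fh.
Qed.

Lemma diffeo_on_comp a b f g : a < b -> f a < f b -> g (f a) < g (f b) ->
  diffeo_on a b f -> diffeo_on (f a) (f b) g -> diffeo_on a b (g \o f).
Proof.
move=> ab fab gfab [fs fE [f' f's ff']] [gs gE [g' g's gg']].
have fAB x : x \in `[a, b] -> f x \in `[f a, f b].
  by move=> xab; have : `[f a, f b]%classic (f x) by rewrite -fE; exists x.
split; first exact: smooth_in_comp fAB gs fs.
  by rewrite -image_comp fE; exact: gE.
exists (f' \o g'); last by move=> x xab /=; rewrite gg' ?fAB// ff'.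
apply: smooth_in_comp f's g's => // y.
rewrite -[`[_, _]%classic]gE => -[z zfab <-].
by rewrite gg'.
Qed.

Lemma diffeo_on_affine a b (c d : R) : a < b -> 0 < c ->
  diffeo_on a b (fun x => c * x + d).
Proof.
move=> ab c0; have cs := @smooth_in_affine _ _ _ ab c d.
apply: diffeo_onI => // x Ax.
have : is_der_in `[a, b] (fun x => c * x + d) x (0 * x + c * 1 + 0).
  apply: is_der_inD; last exact: is_der_in_cst.
  by apply: is_der_inM; [exact: is_der_in_cst|exact: is_der_in_id].
by rewrite mul0r mulr1 add0r addr0 => /(derive_in_val ab Ax) ->.
Qed.

(** Here [g] inverts [f] everywhere, not only on the segment. *)
Lemma diffeo_on_inverse a b f g : cancel f g -> diffeo_on a b f ->
  diffeo_on (f a) (f b) g.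
Proof.
move=> fg [fs fE [f' f's ff']]; split.
- apply: eq_smooth_in f's => y /[!inE]; rewrite -fE => -[x xab <-].
  by rewrite fg ff'.
- rewrite !fg -fE image_comp; apply/seteqP; split => [_ [x xab <-]|x xab] /=.
    by rewrite fg.
  by exists x => //=; rewrite fg.
- exists f; rewrite ?fg// => y yab.
  have : `[f a, f b]%classic y by [].
  by rewrite -fE => -[x xab <-]; rewrite fg.
Qed.

Local Notation mu := (@lebesgue_measure R).

Lemma segment_integrable a b f : {within `[a, b], continuous f} ->
  mu.-integrable `[a, b] (EFin \o f).
Proof.
move=> fc; apply: continuous_compact_integrable => //.
exact: segment_compact.
Qed.

(** Change of variables by a function differentiable on a closed segment in the
    one-sided sense. *)
Lemma Rintegral_substitution a b G g K : a < b ->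
  {in `[a, b] &, {homo G : x y / x < y}} ->
  (forall x, `[a, b]%classic x -> is_der_in `[a, b] G x (g x)) ->
  {within `[a, b], continuous g} -> {within `[G a, G b], continuous K} ->
  \int[mu]_(x in `[G a, G b]) K x = \int[mu]_(x in `[a, b]) (K (G x) * g x).
Proof.
move=> ab Gincr Gg gc Kc.
have Gc := is_der_in_within_continuous Gg.
have /(continuous_within_itvP _ ab)[goo ga gb] := gc.
have /(continuous_within_itvP _ ab)[Goo Ga Gb] := Gc.
have Gd x : x \in `]a, b[ -> is_derive x 1 G (g x).
  by move=> xab; apply: is_der_in_is_derive (xab) (Gg _ (subset_itv_oo_cc xab)).
have G'g x : x \in `]a, b[ -> derive1 G x = g x.
  by move=> xab; rewrite derive1E; have [_ ->] := Gd x xab.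
have cd x : x \in `]a, b[ ->
    ((K \o G) * (derive1 G : R -> R)) x = K (G x) * g x.
  by move=> xab; rewrite -G'g.
have Kgc : {within `[a, b], continuous (fun x => K (G x) * g x)}.
  apply/subspace_continuousP => x Ax.
  apply: cvgM; last by move/subspace_continuousP: gc; apply.
  have GA y : `[a, b]%classic y -> `[G a, G b]%classic (G y).
    by rewrite -(segment_image ab Gincr Gc) => Ay; exists y.
  move/subspace_continuousP: Kc => /(_ _ (GA x Ax)) Kx P HP.
  have {}HP : nbhs (G x) (fun z => `[G a, G b]%classic z -> P (K z)) := Kx P HP.
  move/subspace_continuousP: Gc => /(_ x Ax)/(_ _ HP) H.
  have {}H : nbhs x (fun z => `[a, b]%classic z ->
    `[G a, G b]%classic (G z) -> P (K (G z))) := H.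
  change (nbhs x (fun z => `[a, b]%classic z -> P (K (G z)))).
  by apply: filterS H => z Hz Az; apply: Hz => //; exact: GA.
have ioo : (`]a, b[%classic : set R) `<=` `[a, b]%classic.
  exact: subset_itv_oo_cc.
have mKg : measurable_fun (`]a, b[%classic : set R) (fun x => K (G x) * g x).
  apply: measurable_funS ioo _ => //.
  exact: subspace_continuous_measurable_fun.
rewrite /Rintegral integration_by_substitution_increasing ?ltW//.
- congr fine; apply: eq_integral_itv_bounded => //.
  by apply: eq_measurable_fun mKg => x /[!inE] xab; rewrite cd.
- move=> x xab; have /= gx := goo x xab.
  rewrite /continuous_at G'g//; apply: cvg_trans gx; apply: near_eq_cvg.
  have /= xN : nbhs x (`]a, b[%classic : set R).
    by apply: open_nbhs_nbhs; split => //; exact: interval_open.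
  by apply: filterS xN => z zab; rewrite G'g.
- apply/cvg_ex; exists (g a); apply: cvg_trans ga; apply: near_eq_cvg.
  by near=> z; rewrite G'g// in_itv/=; apply/andP; split; near: z;
    [exact: nbhs_right_gt|exact: nbhs_right_lt].
- apply/cvg_ex; exists (g b); apply: cvg_trans gb; apply: near_eq_cvg.
  by near=> z; rewrite G'g// in_itv/=; apply/andP; split; near: z;
    [exact: nbhs_left_gt|exact: nbhs_left_lt].
- by split => // x xab; have [] := Gd x xab.
Unshelve. all: by end_near. Qed.

End Diffeomorphisms_of_segments.

(** * Lifts of circle maps and of arcs *)

Section Circle_lifts.
Context {R : realType}.
Implicit Types (x y s t : R) (p q : S1 R) (k m : int) (F G : R -> R).
Implicit Types (phi psi : S1 R -> S1 R).

Lemma toS1P x y : reflect (exists k, x = y + k%:~R) (toS1 x == toS1 y).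
Proof.
apply: (iffP eqP) => [/eqquotP/intrP[k xyk]|[k ->]].
  by exists k; rewrite -xyk addrC subrK.
by apply/eqquotP; rewrite /= /circle_rel addrAC subrr add0r intr_int.
Qed.

Lemma toS1D x k : toS1 (x + k%:~R) = toS1 x.
Proof. by apply/eqP/toS1P; exists k. Qed.

Lemma toS1_surj p : exists x, toS1 x = p.
Proof. by exists (repr p); rewrite /toS1 reprK. Qed.

Lemma lift_intD F : (forall x, F (x + 1) = F x + 1) ->
  forall x k, F (x + k%:~R) = F x + k%:~R.
Proof.
move=> F1; have Fn x n : F (x + n%:R) = F x + n%:R.
  elim: n => [|n IH]; first by rewrite !addr0.
  by rewrite -natr1 addrA F1 IH addrA.
move=> x [n|n]; first exact: Fn.
by rewrite NegzE mulrNz -[in RHS](subrK n.+1%:R x) Fn addrK.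
Qed.

(** Two lifts of a circle map differ by an integer: their difference is
    continuous and integer-valued. *)
Lemma lift_unique phi F G : is_lift phi F -> is_lift phi G ->
  exists k, forall x, G x = F x + k%:~R.
Proof.
move=> [Fc _ F1 Fphi] [Gc _ G1 Gphi].
have GF x : exists k, G x - F x = k%:~R.
  have /eqP/toS1P[k ->] : toS1 (G x) = toS1 (F x) by rewrite Gphi Fphi.
  by exists k; rewrite addrAC subrr add0r.
have Dc : continuous (G - F).
  by move=> x; apply: cvgB; [exact: Gc|exact: Fc].
have Dlt x y : x < y -> G x - F x = G y - F y.
  move=> xy; have Dcw : {within `[x, y], continuous (G - F)}.
    exact: continuous_subspaceT.
  have [[k Dk] [m Dm]] := (GF x, GF y).
  rewrite Dk Dm; case: (ltgtP k m) => [km|mk|->//].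
  (* Otherwise the difference would take a half-integer value in between. *)
  - have [|c _ Dc2] := IVT (ltW xy) Dcw (v := k%:~R + 2^-1).
      rewrite -[(G - F) x]/(G x - F x) -[(G - F) y]/(G y - F y) Dk Dm.
      have : (k + 1)%:~R <= m%:~R :> R by rewrite ler_int lezD1.
      rewrite intrD => km1; rewrite ge_min le_max.
      by apply/andP; split; apply/orP; [left|right]; lra.
    have [j] := GF c; rewrite -[G c - F c]/((G - F) c) Dc2 => jk.
    have : k%:~R < j%:~R :> R by lra.
    have : j%:~R < (k + 1)%:~R :> R by rewrite intrD; lra.
    by rewrite !ltr_int ltzD1 leNgt => /negbTE ->.
  - have [|c _ Dc2] := IVT (ltW xy) Dcw (v := m%:~R + 2^-1).
      rewrite -[(G - F) x]/(G x - F x) -[(G - F) y]/(G y - F y) Dk Dm.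
      have : (m + 1)%:~R <= k%:~R :> R by rewrite ler_int lezD1.
      rewrite intrD => km1; rewrite ge_min le_max.
      by apply/andP; split; apply/orP; [right|left]; lra.
    have [j] := GF c; rewrite -[G c - F c]/((G - F) c) Dc2 => jk.
    have : m%:~R < j%:~R :> R by lra.
    have : j%:~R < (m + 1)%:~R :> R by rewrite intrD; lra.
    by rewrite !ltr_int ltzD1 leNgt => /negbTE ->.
have [k Dk] := GF 0; exists k => x; rewrite -Dk.
suff -> : G 0 - F 0 = G x - F x by rewrite addrC subrK.
by case: (ltgtP 0 x) => [/Dlt//|/Dlt//|->].
Qed.

(** [lift_of] returns any given lift up to an integer. *)
Lemma lift_ofP phi F : is_lift phi F ->
  exists k, forall x, lift_of phi x = F x + k%:~R.
Proof.
move=> FL; apply: (lift_unique FL); rewrite /lift_of.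
by case: xgetP => // /(_ F).
Qed.

(** Two lifts of an arc differ by an integer translation. *)
Lemma arc_lift_unique p q ab cd : @is_arc_lift R p q ab -> is_arc_lift p q cd ->
  exists k, cd = (ab.1 + k%:~R, ab.2 + k%:~R).
Proof.
case: ab cd => [a b] [c d] [/= <- <- /andP[ab ba]] [/=].
move=> /eqP/toS1P[k ->] /eqP/toS1P[m ->] /andP[cd dc].
exists k; suff -> : m = k by [].
apply/eqP; rewrite eq_le -!ltzD1 -!(ltr_int R) !intrD.
by apply/andP; split; lra.
Qed.

Lemma arc_liftP p q : is_arc_lift p q (arc_lift p q).
Proof.
rewrite /arc_lift; case: xgetP => // H; exfalso.
have [[a ap] [b bq]] := (toS1_surj p, toS1_surj q).
(* The only translate of [b] by an integer in the half-open interval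
   from [a] (excluded) to [a + 1] (included). *)
apply: (H (a, b + (Num.floor (a - b) + 1)%:~R)).
split => //=; first by rewrite toS1D.
rewrite intrD; have := floor_le (a - b); have := floorD1_gt (a - b).
by rewrite intrD => ? ?; apply/andP; split; lra.
Qed.

Lemma is_arc_lift_map phi F p q s t : is_lift phi F ->
  is_arc_lift p q (s, t) -> is_arc_lift (phi p) (phi q) (F s, F t).
Proof.
move=> [_ Fincr F1 Fphi] [/= <- <- /andP[st ts]]; split => /=; rewrite ?Fphi//.
rewrite Fincr//= -F1; move: ts; rewrite le_eqVlt.
by move=> /predU1P[->//|/Fincr/ltW].
Qed.

Lemma is_arc_lift_shift p q s t k : is_arc_lift p q (s, t) ->
  is_arc_lift p q (s + k%:~R, t + k%:~R).
Proof.
move=> [/= sp tq /andP[st ts]]; split; rewrite /= ?toS1D//.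
by rewrite ltrD2r st/= addrAC lerD2r.
Qed.

(** A strictly increasing surjection of the line is continuous. *)
Lemma homo_surj_continuous F G : {homo F : x y / x < y} -> cancel G F ->
  continuous F.
Proof.
move=> Fincr GK x; apply/cvgrPdist_lt => e e0.
have Fmono : {mono F : u v / u < v} := leW_mono (le_mono Fincr).
have xl : G (F x - e) < x by rewrite -Fmono GK gtrDl oppr_lt0.
have xr : x < G (F x + e) by rewrite -Fmono GK ltrDl.
near=> y; rewrite ltr_distlC -[F x - e]GK -[F x + e]GK !Fmono.
apply/andP; split; near: y; [exact: lt_nbhsr|exact: lt_nbhsl].
Unshelve. all: by end_near. Qed.

(** A lift increases by 1 over each period, hence takes every value. *)
Lemma lift_surj F : continuous F -> (forall x, F (x + 1) = F x + 1) ->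
  forall y, exists x, F x = y.
Proof.
move=> Fc F1 y; pose k := Num.floor (y - F 0).
have Fk := lift_intD F1 0 k; have Fk1 := lift_intD F1 0 (k + 1).
rewrite !add0r in Fk Fk1.
have kk1 : k%:~R <= (k + 1)%:~R :> R by rewrite intrD lerDl.
have [|c _ Fcy] := IVT kk1 (continuous_subspaceT Fc) (v := y); last by exists c.
rewrite Fk Fk1; have := floor_le (y - F 0); have := floorD1_gt (y - F 0).
rewrite -/k !intrD => H1 H2; rewrite ge_min le_max.
by apply/andP; split; apply/orP; [left|right]; lra.
Qed.

Lemma homo_cancel_lift F G : {homo F : x y / x < y} ->
  (forall x, F (x + 1) = F x + 1) -> cancel G F ->
  [/\ cancel F G, continuous F, continuous G, {homo G : x y / x < y} &
     forall x, G (x + 1) = G x + 1].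
Proof.
move=> Fincr F1 GK.
have Fmono : {mono F : u v / u < v} := leW_mono (le_mono Fincr).
have FK : cancel F G by move=> x; apply: (inc_inj (le_mono Fincr)); rewrite GK.
have Gincr : {homo G : x y / x < y} by move=> x y xy; rewrite -Fmono !GK.
split => //; first exact: homo_surj_continuous GK.
  exact: homo_surj_continuous FK.
by move=> x; apply: (inc_inj (le_mono Fincr)); rewrite F1 !GK.
Qed.

Lemma lift_inverse phi psi F : cancel phi psi -> is_lift phi F ->
  exists G, [/\ cancel F G, cancel G F & is_lift psi G].
Proof.
move=> phiK [Fc Fincr F1 Fphi]; have [G GK] := choice (lift_surj Fc F1).
have [FK _ Gc Gincr G1] := homo_cancel_lift Fincr F1 GK.
by exists G; split => //; split => // x; rewrite -{2}[x]GK Fphi phiK.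
Qed.

Lemma is_lift_comp phi psi F G : is_lift phi F -> is_lift psi G ->
  is_lift (phi \o psi) (F \o G).
Proof.
move=> [Fc Fi F1 Fphi] [Gc Gi G1 Gpsi]; split.
- by move=> x; apply: continuous_comp; [exact: Gc|exact: Fc].
- by move=> x y /Gi/Fi.
- by move=> x /=; rewrite G1 F1.
- by move=> x /=; rewrite Fphi Gpsi.
Qed.

(** The circle map induced by [F]; meaningful when [F] commutes with the
    translation by 1. *)
Definition circle_map F : S1 R -> S1 R := fun p => toS1 (F (repr p)).

Lemma circle_mapE F : (forall x, F (x + 1) = F x + 1) ->
  forall x, circle_map F (toS1 x) = toS1 (F x).
Proof.
move=> F1 x; rewrite /circle_map.
have /eqP/toS1P[k ->] : toS1 (repr (toS1 x)) = toS1 x by rewrite /toS1 reprK.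
by rewrite (lift_intD F1) toS1D.
Qed.

Lemma circle_map_continuous F : continuous F ->
  (forall x, F (x + 1) = F x + 1) -> continuous (circle_map F).
Proof.
move=> Fc F1; apply/quotient_continuous.
rewrite [X in continuous X](_ : _ = @toS1 R \o F); last first.
  by apply/funext => x; rewrite /= -circle_mapE.
by move=> x; apply: continuous_comp; [exact: Fc|exact: pi_continuous].
Qed.

Lemma homeo_circle_map F G : {homo F : x y / x < y} ->
  (forall x, F (x + 1) = F x + 1) -> cancel G F ->
  homeo (circle_map F) /\ is_lift (circle_map F) F.
Proof.
move=> Fincr F1 GK; have [FK Fc Gc Gincr G1] := homo_cancel_lift Fincr F1 GK.
split; last by split => // x; rewrite circle_mapE.
split; first exact: circle_map_continuous.
exists (circle_map G); split; first exact: circle_map_continuous.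
  by move=> p; have [x <-] := toS1_surj p; rewrite !circle_mapE// FK.
by move=> p; have [x <-] := toS1_surj p; rewrite !circle_mapE// GK.
Qed.

End Circle_lifts.

(** * The logarithmic integral and its cocycle identity *)

(** The integral of log F'(G) d log G' over [s, t], with derivatives relative to
    [G s, G t] and [s, t]. Locked, because comparing two such integrals by
    conversion would unfold the limits under the integral sign. *)
HB.lock Definition log_int {R : realType} (F G : R -> R) (s t : R) : R :=
  \int[@lebesgue_measure R]_(x in `[s, t])
    (ln (derive_in `[G s, G t] F (G x)) *
     derive_in `[s, t] (fun z => ln (derive_in `[s, t] G z)) x).

Section Logarithmic_integral.
Context {R : realType}.
Implicit Types (F G H : R -> R) (s t x c : R).
Local Notation mu := (@lebesgue_measure R).

(** [G] is an increasing diffeomorphism of [s, t] onto its image. *)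
Variant incr_diffeo s t G : Prop := IncrDiffeo of s < t
  & {in `[s, t] &, {homo G : x y / x < y}} & smooth_in `[s, t] G
  & forall x, `[s, t]%classic x -> 0 < derive_in `[s, t] G x.

Lemma incr_diffeo_lt s t G : incr_diffeo s t G -> G s < G t.
Proof. by move=> [st Gi _ _]; rewrite Gi// bound_itvE ltW. Qed.

Lemma incr_diffeo_image s t G x : incr_diffeo s t G ->
  `[s, t]%classic x -> `[G s, G t]%classic (G x).
Proof.
move=> [st Gi Gs _] xst.
by rewrite -(segment_image st Gi (smooth_in_continuous Gs)); exists x.
Qed.

Lemma incr_diffeo_on s t G : incr_diffeo s t G -> diffeo_on s t G.
Proof. by move=> [st Gi Gs G0]; exact: diffeo_onI. Qed.

Lemma diffeo_on_incr s t G : s < t -> {homo G : x y / x < y} ->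
  diffeo_on s t G -> incr_diffeo s t G.
Proof.
move=> st Gi Gd; have Gi' : {in `[s, t] &, {homo G : x y / x < y}}.
  by move=> *; exact: Gi.
split => //; first by case: Gd.
exact: diffeo_on_derive_gt0.
Qed.

Lemma incr_diffeo_is_der s t G x : incr_diffeo s t G -> `[s, t]%classic x ->
  is_der_in `[s, t] G x (derive_in `[s, t] G x).
Proof. by move=> [_ _ Gs _]; exact: smooth_in_der. Qed.

Lemma derive_in_comp s t F G x : incr_diffeo s t G ->
  incr_diffeo (G s) (G t) F -> `[s, t]%classic x ->
  derive_in `[s, t] (F \o G) x =
  derive_in `[G s, G t] F (G x) * derive_in `[s, t] G x.
Proof.
move=> Gd Fd xst; have [st _ _ _] := Gd; apply: (derive_in_val st xst).
have GA y := incr_diffeo_image (x := y) Gd.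
exact: (is_der_in_comp GA xst (incr_diffeo_is_der Fd (GA _ xst))
  (incr_diffeo_is_der Gd xst)).
Qed.

Lemma incr_diffeo_comp s t F G : incr_diffeo s t G ->
  incr_diffeo (G s) (G t) F -> incr_diffeo s t (F \o G).
Proof.
move=> Gd Fd; have [st Gi Gs G0] := Gd; have [_ Fi Fs F0] := Fd.
have GA x := incr_diffeo_image (x := x) Gd.
split => //.
- by move=> x y xst yst xy /=; apply: Fi; [exact: GA|exact: GA|exact: Gi].
- exact: smooth_in_comp GA Fs Gs.
- by move=> x xst; rewrite derive_in_comp// mulr_gt0 ?G0 ?F0//; exact: GA.
Qed.

Lemma smooth_ln_derive s t G : incr_diffeo s t G ->
  smooth_in `[s, t] (fun z => ln (derive_in `[s, t] G z)).
Proof.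
by move=> [st _ Gs G0]; apply: smooth_in_ln => //; exact: smooth_in_derive.
Qed.

Lemma segment_RintegralD (a b : R) (u v : R -> R) :
  {within `[a, b], continuous u} -> {within `[a, b], continuous v} ->
  \int[mu]_(x in `[a, b]) (u x + v x) =
  \int[mu]_(x in `[a, b]) u x + \int[mu]_(x in `[a, b]) v x.
Proof.
move=> uc vc; rewrite RintegralD//; exact: segment_integrable.
Qed.

(** With f, g, h the derivatives of F, G, H and u = log f o G o H, the four
    integrands are u (log g o H)' + u (log h)', (log g o H) (log h)',
    (u + log g o H) (log h)' and, after the change of variables by H,
    u (log g o H)'. *)
Lemma log_int_cocycle F G H s t : incr_diffeo s t H ->
  incr_diffeo (H s) (H t) G -> incr_diffeo (G (H s)) (G (H t)) F ->
  log_int F (G \o H) s t + log_int G H s t =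
  log_int (F \o G) H s t + log_int F G (H s) (H t).
Proof.
move=> Hd Gd Fd; have [st Hi Hs H0] := Hd; have [_ Gi Gs G0] := Gd.
have [_ _ Fs F0] := Fd.
have HA x := incr_diffeo_image (x := x) Hd.
have GA x := incr_diffeo_image (x := x) Gd.
have lfs := smooth_ln_derive Fd; have lgs := smooth_ln_derive Gd.
have lhs := smooth_ln_derive Hd.
set A := (`[s, t]%classic : set R) in Hs H0 HA lhs *.
set B := (`[H s, H t]%classic : set R) in Gs G0 HA GA lgs *.
set C := (`[G (H s), G (H t)]%classic : set R) in Fs F0 GA lfs *.
set h := derive_in A H in H0 lhs; set g := derive_in B G in G0 lgs.
set f := derive_in C F in F0 lfs.
set lf := (fun z => ln (f z)) in lfs; set lg := (fun z => ln (g z)) in lgs.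
set lh := (fun z => ln (h z)) in lhs.
set lg' := derive_in B lg; set lh' := derive_in A lh.
have uc : smooth_in A (lf \o (G \o H)).
  apply: (smooth_in_comp st (B := C)) lfs _ => [x Ax|].
    by apply: GA; exact: HA.
  exact: (smooth_in_comp st HA Gs Hs).
have cont (u : R -> R) : smooth_in A u -> {within A, continuous u}.
  exact: smooth_in_continuous.
have cM (u v : R -> R) : {within A, continuous u} -> {within A, continuous v} ->
    {within A, continuous (fun x => u x * v x)}.
  move=> /subspace_continuousP cu /subspace_continuousP cv.
  by apply/subspace_continuousP => x Ax; apply: cvgM; [exact: cu|exact: cv].
have ucc := cont _ uc.
have lgHc : {within A, continuous (fun x => lg (H x))}.
  exact: cont (smooth_in_comp st HA lgs Hs).
have lg'Hc : {within A, continuous (fun x => lg' (H x))}.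
  exact: cont (smooth_in_comp st HA (smooth_in_derive lgs) Hs).
have hc : {within A, continuous h} by apply: cont; exact: smooth_in_derive.
have lh'c : {within A, continuous lh'} by apply: cont; exact: smooth_in_derive.
have lnGH : {in A, (fun z => ln (derive_in A (G \o H) z)) =1
    (fun z => lg (H z) + lh z)}.
  move=> z /[!inE] Az; rewrite /lg /lh derive_in_comp// lnM ?posrE//.
    by apply: G0; exact: HA.
  exact: H0.
have E1 x : x \in A -> ln (derive_in C F ((G \o H) x)) *
    derive_in A (fun z => ln (derive_in A (G \o H) z)) x =
    lf (G (H x)) * lg' (H x) * h x + lf (G (H x)) * lh' x.
  move=> /[!inE] Ax; rewrite [derive_in A _ x](_ : _ = lg' (H x) * h x + lh' x).
    by rewrite mulrDr mulrA.
  apply: (derive_in_val st Ax).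
  apply: (@is_der_in_eq _ _ ((lg \o H) + lh)) => //.
    by move=> z Az; rewrite lnGH.
  apply: is_der_inD; last exact: smooth_in_der lhs Ax.
  apply: (is_der_in_comp HA Ax); last exact: smooth_in_der Hs Ax.
  exact: smooth_in_der lgs (HA _ Ax).
have E3 x : x \in A -> ln (derive_in B (F \o G) (H x)) * lh' x =
    lf (G (H x)) * lh' x + lg (H x) * lh' x.
  move=> /[!inE] Ax; rewrite derive_in_comp//; last exact: HA.
  rewrite lnM ?posrE ?mulrDl//; first by apply: F0; apply: GA; exact: HA.
  by apply: G0; exact: HA.
pose u1 x := lf (G (H x)) * lg' (H x) * h x.
pose u2 x := lf (G (H x)) * lh' x; pose u3 x := lg (H x) * lh' x.
have I1 : log_int F (G \o H) s t = \int[mu]_(x in A) (u1 x + u2 x).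
  by rewrite log_int.unlock; exact: (eq_Rintegral mu E1).
have I3 : log_int (F \o G) H s t = \int[mu]_(x in A) (u2 x + u3 x).
  by rewrite log_int.unlock; exact: (eq_Rintegral mu E3).
have lfGc : {within B, continuous (fun y => lf (G y) * lg' y)}.
  apply/subspace_continuousP => y By; apply: cvgM.
    have /subspace_continuousP := smooth_in_continuous
      (smooth_in_comp (incr_diffeo_lt Hd) GA lfs Gs); exact.
  by have /subspace_continuousP := smooth_in_continuous (smooth_in_derive lgs);
    exact.
have I4 : log_int F G (H s) (H t) = \int[mu]_(x in A) u1 x.
  rewrite log_int.unlock.
  apply: (Rintegral_substitution st Hi _ hc lfGc) => x Ax.
  exact: smooth_in_der Hs Ax.
have c1 : {within A, continuous u1} by exact: (@cM _ _ (@cM _ _ ucc lg'Hc) hc).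
have c2 : {within A, continuous u2} by exact: (@cM _ _ ucc lh'c).
have c3 : {within A, continuous u3} by exact: (@cM _ _ lgHc lh'c).
have S1 := segment_RintegralD c1 c2; have S3 := segment_RintegralD c2 c3.
have I2 : log_int G H s t = \int[mu]_(x in A) u3 x.
  by rewrite log_int.unlock.
have add_eq (y1 y2 y3 y4 a b c : R) : y1 = a + b -> y2 = c -> y3 = b + c ->
    y4 = a -> y1 + y2 = y3 + y4.
  by move=> -> -> -> ->; rewrite -addrA addrC.
exact: add_eq (etrans I1 S1) I2 (etrans I3 S3) I4.
Qed.

(** The translation of the line by [c]. *)
Definition translation c x : R := x + c.

Lemma incr_diffeo_translation c s t : s < t -> incr_diffeo s t (translation c).
Proof.
move=> st; apply: diffeo_on_incr => //.
  by move=> x y; rewrite /translation ltrD2r.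
apply: (eq_diffeo_on st (f := fun x => 1 * x + c)).
  by move=> x _; rewrite /translation mul1r.
exact: diffeo_on_affine.
Qed.

Lemma derive_in_translation c s t x : s < t -> `[s, t]%classic x ->
  derive_in `[s, t] (translation c) x = 1.
Proof.
move=> st xst; apply: (derive_in_val st xst).
have := is_der_inD (is_der_in_id `[s, t]%classic x)
  (is_der_in_cst `[s, t]%classic c x).
by rewrite addr0.
Qed.

Lemma log_int_translationl c G s t : incr_diffeo s t G ->
  log_int (translation c) G s t = 0.
Proof.
move=> Gd; have Gst := incr_diffeo_lt Gd.
rewrite log_int.unlock (_ : 0 = \int[mu]_(x in `[s, t]) (0 : R)).
  apply: eq_Rintegral => x /[!inE] xst.
  by rewrite derive_in_translation ?ln1 ?mul0r//; exact: incr_diffeo_image xst.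
by rewrite Rintegral_cst ?mul0r//; exact: measurable_itv.
Qed.

Lemma log_int_translationr c F s t : s < t -> log_int F (translation c) s t = 0.
Proof.
move=> st; rewrite log_int.unlock (_ : 0 = \int[mu]_(x in `[s, t]) (0 : R)).
  apply: eq_Rintegral => x /[!inE] xst.
  rewrite [X in _ * X](_ : _ = 0) ?mulr0//; apply: (derive_in_val st xst).
  apply: is_der_in_eq (is_der_in_cst `[s, t]%classic 0 x) => // y /[!inE] yst.
  by rewrite derive_in_translation ?ln1.
by rewrite Rintegral_cst ?mul0r//; exact: measurable_itv.
Qed.

End Logarithmic_integral.

(** * The groupoid of broken diffeomorphisms and its extension *)

Section Groupoid.
Context {R : realType} {n : nat}.
Implicit Types (a b c : arrow R n) (phi psi eta : arrow R n) (F G : R -> R).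
Implicit Types (s t x y : R) (k m : int) (i : 'I_n) (p : config R n).

(** The lifts of the [i]-th arc of the configuration [p]. *)
Definition arc_of p i : R * R -> Prop := is_arc_lift (p i) (p (ordS i)).

Lemma arc_lt p i s t : arc_of p i (s, t) -> s < t.
Proof. by case=> _ _ /andP[]. Qed.

Lemma arc_trg a F i s t : is_lift a.2 F -> arc_of (src a) i (s, t) ->
  arc_of (trg a) i (F s, F t).
Proof. by move=> aF; exact: is_arc_lift_map. Qed.

Lemma src_arcP a i : arc_of (src a) i (src_arc a i).
Proof. exact: arc_liftP. Qed.

Lemma diffeo_on_shift (a b : R) (f : R -> R) (c d : R) : a < b -> f a < f b ->
  diffeo_on a b f -> diffeo_on (a + c) (b + c) (fun x => f (x - c) + d).
Proof.
move=> ab fab fd; have abc : a + c < b + c by rewrite ltrD2r.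
pose A1 x := 1 * x - c; pose A2 x := 1 * x + d.
have A1E x : A1 x = x - c by rewrite /A1 mul1r.
have A2E x : A2 x = x + d by rewrite /A2 mul1r.
apply: (eq_diffeo_on abc (f := A2 \o (f \o A1))).
  by move=> x _ /=; rewrite A1E A2E.
have A1a : A1 (a + c) = a by rewrite A1E addrK.
have A1b : A1 (b + c) = b by rewrite A1E addrK.
apply: diffeo_on_comp => //=.
- by rewrite A1a A1b.
- by rewrite A1a A1b !A2E ltrD2r.
- apply: diffeo_on_comp => //; rewrite ?A1a ?A1b//.
  by apply: diffeo_on_affine.
- by rewrite A1a A1b; exact: diffeo_on_affine.
Qed.

(** The condition that defines [BDiff] holds for all lifts of the map and of its
    arcs as soon as it holds for one. *)
Lemma BDiff_diffeo_on a F i s t : BDiff a -> is_lift a.2 F ->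
  arc_of (src a) i (s, t) -> diffeo_on s t F.
Proof.
move=> [_ _ [F0 F0l F0d]] Fl st.
have [m Fm] := lift_unique F0l Fl.
have [k [-> ->]] := arc_lift_unique (src_arcP a i) st.
have [_ F0i F01 _] := F0l.
have ab := arc_lt (src_arcP a i : arc_of _ _ (_, _)).
set u := (src_arc a i).1; set v := (src_arc a i).2.
have : diffeo_on (u + k%:~R) (v + k%:~R)
    (fun x => F0 (x - k%:~R) + (k%:~R + m%:~R)).
  by apply: diffeo_on_shift; [exact: ab|exact: F0i|exact: F0d].
apply: eq_diffeo_on; first by rewrite ltrD2r.
by move=> x _; rewrite Fm -[in RHS](subrK k%:~R x) (lift_intD F01) addrA.
Qed.

Lemma BDiff_incr_diffeo a F i s t : BDiff a -> is_lift a.2 F ->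
  arc_of (src a) i (s, t) -> incr_diffeo s t F.
Proof.
move=> aB aF st; have [_ Fi _ _] := aF.
apply: diffeo_on_incr => //; first exact: arc_lt st.
exact: BDiff_diffeo_on st.
Qed.

Lemma BDiffI a F : Bconf (src a) -> homeo a.2 -> is_lift a.2 F ->
  (forall i s t, arc_of (src a) i (s, t) -> diffeo_on s t F) -> BDiff a.
Proof.
move=> ap ah aF ad; split=> //; exists F => // i.
by apply: ad; rewrite -surjective_pairing; exact: src_arcP.
Qed.

Lemma BDiff_lift a : BDiff a -> exists F, is_lift a.2 F.
Proof. by move=> [_ _ [F Fl _]]; exists F. Qed.

Lemma Bconf_trg a : BDiff a -> Bconf (trg a).
Proof.
move=> [[x [xp xi xc]] _ [F [_ Fi F1 Fphi] _]]; exists (F \o x); split.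
- by move=> i; rewrite /= Fphi xp.
- by move=> i j ij /=; apply/Fi/xi.
- by move=> i j /=; rewrite -F1; exact/Fi.
Qed.

Lemma homeo_comp (f g : S1 R -> S1 R) : homeo f -> homeo g -> homeo (f \o g).
Proof.
move=> [fc [f' [f'c fK f'K]]] [gc [g' [g'c gK g'K]]]; split.
  by move=> x; apply: continuous_comp; [exact: gc|exact: fc].
exists (g' \o f'); split; [|exact: can_comp|exact: can_comp].
by move=> x; apply: continuous_comp; [exact: f'c|exact: g'c].
Qed.

Lemma trg_bcomp a b : src a = trg b -> trg (bcomp a b) = trg a.
Proof.
by move=> ab; rewrite /trg -[a.1]/(src a) ab.
Qed.

Lemma BDiff_comp a b : BDiff a -> BDiff b -> src a = trg b -> BDiff (bcomp a b).
Proof.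
move=> aB bB ab; have [F Fl] := BDiff_lift aB; have [G Gl] := BDiff_lift bB.
have [[_ ah _] [bp bh _]] := (aB, bB).
apply: (@BDiffI _ (F \o G)) => //; [exact: homeo_comp|exact: is_lift_comp|].
move=> i s t st; apply: incr_diffeo_on; apply: incr_diffeo_comp.
  exact: (BDiff_incr_diffeo bB Gl st).
apply: (BDiff_incr_diffeo aB Fl (i := i)).
by rewrite ab; exact: (arc_trg Gl st).
Qed.

(** The identity arrow at [p]. *)
Definition unit_arrow p : arrow R n := (p, idfun).

Lemma is_lift_id : is_lift (idfun : S1 R -> S1 R) (translation 0).
Proof.
split; rewrite /translation.
- by move=> x; apply: cvgD; [exact: cvg_id|exact: cvg_cst].
- by move=> x y; rewrite ltrD2r.
- by move=> x; rewrite !addr0.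
- by move=> x; rewrite addr0.
Qed.

Lemma BDiff_unit p : Bconf p -> BDiff (unit_arrow p).
Proof.
move=> pB; have idh : homeo (idfun : S1 R -> S1 R).
  split; first by move=> x; exact: cvg_id.
  by exists idfun; split=> // x; exact: cvg_id.
apply: (@BDiffI (unit_arrow p) _ pB idh is_lift_id) => i s t /arc_lt st.
apply: incr_diffeo_on.
exact: incr_diffeo_translation.
Qed.

Lemma BDiff_inverse a : BDiff a -> exists b, [/\ BDiff b, src b = trg a,
  trg b = src a, bcomp b a = unit_arrow (src a) &
  bcomp a b = unit_arrow (trg a)].
Proof.
move=> aB; have [F Fl] := BDiff_lift aB.
have [ap [ac [psi [psic aK psiK]]] _] := aB.
have [G [FK GK Gl]] := lift_inverse aK Fl.
have bE : psi \o a.2 = idfun by apply/funext.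
have aE : a.2 \o psi = idfun by apply/funext.
exists (trg a, psi); split => //.
- apply: (BDiffI (F := G)) => //; first exact: Bconf_trg.
    by split => //; exists a.2.
  move=> i s t st.
  have st' : arc_of (src a) i (G s, G t).
    have := is_arc_lift_map Gl st; rewrite /= /arc_of /src /trg /=.
    by rewrite !aK.
  rewrite -(GK s) -(GK t); apply: diffeo_on_inverse FK _.
  exact: (BDiff_diffeo_on aB Fl st').
- by rewrite /trg/= compA bE.
- by rewrite /bcomp/= bE.
- by rewrite /bcomp/= aE.
Qed.

Lemma BDiff_groupoid :
  is_groupoid (@Bconf R n) (@BDiff R n) (@src R n) (@trg R n) (@bcomp R n).
Proof.
split.
- by move=> a aB; split; [case: aB|exact: Bconf_trg].
- move=> a b aB bB ab; split => //; first exact: BDiff_comp.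
  exact: trg_bcomp.
- by [].
- exists unit_arrow; split => [p pB|a aB].
    by split=> //; exact: BDiff_unit.
  split; [by case: a {aB}|by case: a {aB}|].
  by have [b [? ? ? ? ?]] := BDiff_inverse aB; exists b.
Qed.

Lemma chi_log_int phi psi i : chi phi psi 0 i =
  log_int (lift_of phi.2) (lift_of psi.2) (src_arc psi i).1 (src_arc psi i).2.
Proof. by rewrite mxE log_int.unlock. Qed.

(** The next three lemmas move a translation across [log_int]: they are the
    cocycle identity with a translation as one of its three maps. *)
Lemma log_intTl (c : R) F G s t : incr_diffeo s t G ->
  incr_diffeo (G s) (G t) F ->
  log_int (translation c \o F) G s t = log_int F G s t.
Proof.
move=> Gd Fd; have FGd := incr_diffeo_comp Gd Fd.
have Td := incr_diffeo_translation c (incr_diffeo_lt Fd).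
have := log_int_cocycle Gd Fd Td.
by rewrite !log_int_translationl// add0r addr0 => ->.
Qed.

Lemma log_intTm (c : R) F G s t : incr_diffeo s t G ->
  incr_diffeo (translation c (G s)) (translation c (G t)) F ->
  log_int F (translation c \o G) s t = log_int (F \o translation c) G s t.
Proof.
move=> Gd Fd; have Gst := incr_diffeo_lt Gd.
have := log_int_cocycle Gd (incr_diffeo_translation c Gst) Fd.
by rewrite log_int_translationl// log_int_translationr// !addr0.
Qed.

Lemma log_intTr (c : R) F G s t : s < t ->
  incr_diffeo (translation c s) (translation c t) G ->
  incr_diffeo (G (translation c s)) (G (translation c t)) F ->
  log_int F G (translation c s) (translation c t) =
  log_int F (G \o translation c) s t.
Proof.
move=> st Gd Fd.
have := log_int_cocycle (incr_diffeo_translation c st) Gd Fd.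
by rewrite !log_int_translationr// add0r addr0 => ->.
Qed.

Lemma is_lift_translation (f : S1 R -> S1 R) F k : is_lift f F ->
  is_lift f (translation k%:~R \o F).
Proof.
move=> [Fc Fi F1 Ff]; rewrite /translation; split => /=.
- by move=> x; apply: cvgD; [exact: Fc|exact: cvg_cst].
- by move=> x y xy; rewrite ltrD2r Fi.
- by move=> x; rewrite F1 addrAC.
- by move=> x; rewrite toS1D Ff.
Qed.

Lemma lift_translationC (f : S1 R -> S1 R) F k : is_lift f F ->
  F \o translation k%:~R = translation k%:~R \o F.
Proof.
by move=> [_ _ F1 _]; apply/funext => x; exact: lift_intD.
Qed.

(** The components of [chi] may be computed with any lifts of the two maps and
    of the arc. *)
Lemma chi_lift phi psi F G i s t :
  BDiff phi -> BDiff psi -> src phi = trg psi ->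
  is_lift phi.2 F -> is_lift psi.2 G -> arc_of (src psi) i (s, t) ->
  chi phi psi 0 i = log_int F G s t.
Proof.
move=> phiB psiB pp phiF psiG st.
have [k1 F0] := lift_ofP phiF; have [k2 G0] := lift_ofP psiG.
have [k st0] := arc_lift_unique st (src_arcP psi i).
rewrite chi_log_int.
rewrite st0 /= (_ : lift_of phi.2 = translation k1%:~R \o F); last exact/funext.
rewrite (_ : lift_of psi.2 = translation k2%:~R \o G); last exact/funext.
have Gd G' s' t' : is_lift psi.2 G' -> arc_of (src psi) i (s', t') ->
  incr_diffeo s' t' G' by exact: BDiff_incr_diffeo.
have Fd F' G' s' t' : is_lift phi.2 F' -> is_lift psi.2 G' ->
    arc_of (src psi) i (s', t') -> incr_diffeo (G' s') (G' t') F'.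
  move=> F'l G'l st'; apply: (BDiff_incr_diffeo phiB F'l (i := i)).
  by rewrite pp; exact: (arc_trg G'l st').
have T (f : S1 R -> S1 R) F' m := @is_lift_translation f F' m.
have stk : arc_of (src psi) i (translation k%:~R s, translation k%:~R t).
  exact: is_arc_lift_shift.
rewrite -[s + _]/(translation k%:~R s) -[t + _]/(translation k%:~R t).
(* Strip the translations one by one: first those of the two lifts, then that
   of the arc, using that lifts commute with integer translations. *)
rewrite log_intTl; [|exact: Gd (T _ _ _ psiG) stk|exact: Fd (T _ _ _ psiG) stk].
rewrite log_intTm; [|exact: Gd stk|exact: Fd (T _ _ _ psiG) stk].
rewrite (lift_translationC _ phiF) log_intTl; [|exact: Gd stk|exact: Fd stk].
rewrite log_intTr; [|exact: arc_lt st|exact: Gd stk|exact: Fd stk].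
rewrite (lift_translationC _ psiG) log_intTm; [|exact: Gd st|]; last first.
  exact: Fd (T _ _ _ psiG) st.
by rewrite (lift_translationC _ phiF) log_intTl; [|exact: Gd st|exact: Fd st].
Qed.

Lemma chi_cocycle : cocycle (@chi R n).
Proof.
move=> phi psi eta phiB psiB etaB pp pe; apply/rowP => i.
rewrite [LHS]mxE [RHS]mxE.
have [F Fl] := BDiff_lift phiB; have [G Gl] := BDiff_lift psiB.
have [H Hl] := BDiff_lift etaB.
have peB := BDiff_comp psiB etaB pe; have ppB := BDiff_comp phiB psiB pp.
have st : arc_of (src eta) i ((src_arc eta i).1, (src_arc eta i).2).
  by rewrite -surjective_pairing; exact: src_arcP.
have st' : arc_of (src psi) i (H (src_arc eta i).1, H (src_arc eta i).2).
  by rewrite pe; exact: (arc_trg Hl st).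
have ptrg : src phi = trg (bcomp psi eta) by rewrite trg_bcomp.
have E1 := chi_lift phiB peB ptrg Fl (is_lift_comp Gl Hl) st.
have E2 := chi_lift psiB etaB pe Gl Hl st.
have E3 := chi_lift ppB etaB pe (is_lift_comp Fl Gl) Hl st.
have E4 := chi_lift phiB psiB pp Fl Gl st'.
refine (etrans (f_equal2 +%R E1 E2) (etrans _ (esym (f_equal2 +%R E3 E4)))).
apply: log_int_cocycle; first exact: (BDiff_incr_diffeo etaB Hl st).
  exact: (BDiff_incr_diffeo psiB Gl st').
apply: (BDiff_incr_diffeo phiB Fl (i := i)).
by rewrite pp; exact: (arc_trg Gl st').
Qed.

Lemma chi_unitl psi : BDiff psi -> chi (unit_arrow (trg psi)) psi = 0.
Proof.
move=> psiB; apply/rowP => i; rewrite [RHS]mxE.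
have [G Gl] := BDiff_lift psiB.
have st : arc_of (src psi) i ((src_arc psi i).1, (src_arc psi i).2).
  by rewrite -surjective_pairing; exact: src_arcP.
have uB := BDiff_unit (Bconf_trg psiB).
apply: (etrans (chi_lift uB psiB erefl is_lift_id Gl st)).
apply: log_int_translationl.
exact: (BDiff_incr_diffeo psiB Gl st).
Qed.

Lemma chi_unitr phi : BDiff phi -> chi phi (unit_arrow (src phi)) = 0.
Proof.
move=> phiB; apply/rowP => i; rewrite [RHS]mxE.
have [F Fl] := BDiff_lift phiB.
have st : arc_of (src phi) i ((src_arc phi i).1, (src_arc phi i).2).
  by rewrite -surjective_pairing; exact: src_arcP.
have uB : BDiff (unit_arrow (src phi)) by apply: BDiff_unit; case: phiB.
apply: (etrans (chi_lift phiB uB erefl Fl is_lift_id st)).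
apply: log_int_translationr.
exact: arc_lt st.
Qed.

(** A cocycle vanishing on units defines a groupoid extension. The inverse of
    (a, u) is (b, - u - c b a) with b the inverse of a; it is two-sided because
    the cocycle identity for (a, b, a) reads c a b = c b a. *)
Lemma extension_groupoid (c : arrow R n -> arrow R n -> 'rV[R]_n) :
  cocycle c ->
  (forall a, BDiff a -> c (unit_arrow (trg a)) a = 0) ->
  (forall a, BDiff a -> c a (unit_arrow (src a)) = 0) ->
  is_groupoid (@Bconf R n) [set a : ext_arrow R n | BDiff a.1]%classic
    (@ext_src R n) (@ext_trg R n) (ext_mul c).
Proof.
move=> cc cl cr; split.
- by move=> [a u] /= aB; split; [case: aB|exact: Bconf_trg].
- move=> [a u] [b v] /= aB bB ab; split => //; first exact: BDiff_comp.
  exact: trg_bcomp.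
- move=> [a u] [b v] [d w] /= aB bB dB ab bd; rewrite /ext_mul/=; congr (_, _).
  have := cc a b d aB bB dB ab bd.
  set x := c a _; set y := c b d; set z := c _ d => E.
  by rewrite -!addrA (addrC y) E [w + _]addrC -!addrA; do 2 congr (_ + _);
    rewrite addrC -!addrA.
- exists (fun p => (unit_arrow p, 0)); split => [p pB|[a u] /= aB].
    by split=> //=; exact: BDiff_unit.
  rewrite /ext_mul /ext_src /ext_trg /=; split.
  + by rewrite cr// !addr0; case: a {aB}.
  + by rewrite cl// add0r addr0; case: a {aB}.
  + have [b [bB ba ab bca cab]] := BDiff_inverse aB.
    exists (b, - u - c b a); split => //=.
    * by rewrite bca addrAC subrK addNr.
    * rewrite cab; congr (_, _).
      have := cc a b a aB bB aB (esym ab) ba.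
      rewrite bca cab cr// cl// !add0r => ->.
      by rewrite addrA subrr sub0r addNr.
Qed.

End Groupoid.

(** * Polynomial displacements of the unit interval *)

Section Polynomial_displacements.
Context {R : realType} (n : nat).
Implicit Types (p q u v X Y : {poly R}) (W : {poly {poly R}}) (e t : R).

(** [p] minus its affine interpolation at 0 and 1, so that the result vanishes
    at both endpoints and depends linearly on [p]. *)
Definition endpoint_correction p : {poly R} :=
  p - (p.[0]%:P + (p.[1] - p.[0]) *: 'X).

Lemma endpoint_correctionE p t :
  (endpoint_correction p).[t] = p.[t] - (p.[0] + (p.[1] - p.[0]) * t).
Proof. by rewrite !hornerE. Qed.

(** The displacement given by [endpoint_correction p] on every arc, extended by
    0 outside the unit interval. *)
Definition disp_poly_fun p : 'I_n -> R -> R := fun _ t =>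
  if t \in `]0, 1[ then (endpoint_correction p).[t] else 0.

Lemma disp_poly_funE p i t : t \in `[0, 1] ->
  disp_poly_fun p i t = (endpoint_correction p).[t].
Proof.
rewrite /disp_poly_fun !in_itv/= => /andP[]; rewrite !le_eqVlt.
move=> /predU1P[<-|t0] /predU1P[t1|t1].
- by rewrite ltxx/= endpoint_correctionE mulr0 addr0 subrr.
- by rewrite ltxx/= endpoint_correctionE mulr0 addr0 subrr.
- rewrite t1 ltxx andbF endpoint_correctionE mulr1.
  by rewrite [_ + (_ - _)]addrC subrK subrr.
- by rewrite t0 t1.
Qed.

Lemma disp_poly_subproof p : disp_poly_fun p \in @disp_pred R n.
Proof.
apply/asboolP; split => [i|i t /negbTE tI]; last by rewrite /disp_poly_fun tI.
apply: eq_smooth_in (@smooth_in_horner _ _ _ ltr01 (endpoint_correction p)).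
by move=> t /[!inE] tI; rewrite disp_poly_funE.
Qed.

(** The displacement attached to a polynomial: [p] itself on the unit interval
    when [p] vanishes at 0 and 1 ([disp_polyE]), and linear in [p]. *)
Definition disp_poly p : disp R n := Disp (disp_poly_subproof p).

Lemma disp_polyE p i t : p.[0] = 0 -> p.[1] = 0 -> t \in `[0, 1] ->
  disp_poly p i t = p.[t].
Proof.
move=> p0 p1 tI; rewrite [LHS]disp_poly_funE// endpoint_correctionE p0 p1.
by rewrite subrr mul0r addr0 subr0.
Qed.

Lemma disp_poly_linear (a : R) p q :
  disp_poly (a *: p + q) = a *: disp_poly p + disp_poly q.
Proof.
apply/val_inj/funext => i; apply/funext => t.
rewrite -[RHS]/(a * disp_poly_fun p i t + disp_poly_fun q i t).
rewrite -[LHS]/(disp_poly_fun _ i t) /disp_poly_fun; case: ifP => _.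
  by rewrite !endpoint_correctionE !(hornerD, hornerZ); ring.
by rewrite mulr0 addr0.
Qed.

Lemma horner_cons W p e : (W * 'X + p%:P).[e%:P] = e *: W.[e%:P] + p.
Proof. by rewrite hornerMXaddC mulrC mul_polyC. Qed.

Lemma disp_cvgD T (F : set_system T) (FF : Filter F) (f g : T -> disp R n) a b :
  f @ F --> a -> g @ F --> b -> (fun x => f x + g x) @ F --> a + b.
Proof.
move=> fa gb; apply: (@cvg_comp2 _ _ _ _ _ _ _ _ _ _ _ f g
  (fun x y : disp R n => x + y) fa gb).
exact: (@disp_add_continuous R n (a, b)).
Qed.

Lemma disp_cvgZ T (F : set_system T) (FF : Filter F) (k : T -> R)
    (g : T -> disp R n) (a : R) b :
  k @ F --> a -> g @ F --> b -> (fun x => k x *: g x) @ F --> a *: b.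
Proof.
move=> fa gb; apply: (@cvg_comp2 _ _ _ _ _ _ _ _ _ _ _ k g
  (fun (x : R) (y : disp R n) => x *: y) fa gb).
exact: (@disp_scale_continuous R n (a, b)).
Qed.

(** A polynomial family of polynomials gives a curve that is continuous for the
    topology of uniform convergence of all derivatives: it is a finite linear
    combination of fixed displacements. Here and below a polynomial [W] with
    polynomial coefficients stands for the family e |-> W.[e%:P]. *)
Lemma disp_poly_continuous W : continuous (fun e : R => disp_poly W.[e%:P]).
Proof.
elim/poly_ind: W => [|W p IH] e.
  have -> : (fun e : R => disp_poly (0 : {poly {poly R}}).[e%:P]) =
      cst (disp_poly 0).
    by apply/funext => e'; rewrite horner0.
  exact: cvg_cst.
have -> : (fun e : R => disp_poly (W * 'X + p%:P).[e%:P]) =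
    (fun e : R => e *: disp_poly W.[e%:P] + disp_poly p).
  by apply/funext => e'; rewrite horner_cons disp_poly_linear.
apply: disp_cvgD; last exact: cvg_cst.
by apply: disp_cvgZ; [exact: cvg_id|exact: IH].
Qed.

Lemma poly_bounded p :
  exists2 C, 0 < C & forall t, t \in `[0, 1] -> `|p.[t]| <= C.
Proof.
elim/poly_ind: p => [|p c [C C0 IH]].
  by exists 1 => // t _; rewrite horner0 normr0.
exists (C + `|c|); first by rewrite ltr_wpDr.
move=> t tI; rewrite hornerMXaddC (le_trans (ler_normD _ _))// lerD2r normrM.
have t1 : `|t| <= 1 by rewrite ger0_norm (itvP tI).
by rewrite -[C]mulr1 ler_pM// IH.
Qed.

Lemma deriv_family_bounded W : exists2 C, 0 < C & forall e t, `|e| <= 1 ->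
  t \in `[0, 1] -> `|(W.[e%:P])^`().[t]| <= C.
Proof.
elim/poly_ind: W => [|W p [C C0 IH]].
  by exists 1 => // e t _ _; rewrite horner0 deriv0 horner0 normr0.
have [B B0 pB] := poly_bounded p^`().
exists (C + B); first exact: addr_gt0.
move=> e t e1 tI; rewrite horner_cons derivD derivZ hornerD hornerZ.
rewrite (le_trans (ler_normD _ _))// lerD ?pB// normrM.
by rewrite -[C]mul1r ler_pM// IH.
Qed.

(** First-order Taylor expansion of X(x + e Y(x)) with a remainder polynomial in
    both e and x. *)
Lemma comp_poly_taylor X Y : exists W, forall e,
  X \Po ('X + e *: Y) = X + e *: (Y * X^`()) + (e ^+ 2) *: W.[e%:P].
Proof.
elim/poly_ind: X => [|X c [W IH]].
  exists 0 => e; rewrite comp_poly0 deriv0 mulr0 scaler0 horner0 scaler0 !addr0.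
  by [].
exists ((Y ^+ 2 * X^`())%:P + W * ('X%:P + Y%:P * 'X)) => e.
rewrite comp_polyD comp_polyM comp_polyX comp_polyC IH.
rewrite derivD derivM derivX derivC addr0 mulr1.
rewrite !hornerE -!mul_polyC !polyCM ?rmorphXn/=.
by ring.
Qed.

End Polynomial_displacements.

(** * Broken diffeomorphisms with polynomial displacement *)

Section Polynomial_arrows.
Context {R : realType} (n : nat) (n0 : (0 < n)%N).
Implicit Types (u v w : {poly R}) (x y t : R) (i : 'I_n) (k m : int).

(** The polynomials [u] for which x |-> x + u(x) is an increasing diffeomorphism
    of the unit interval. *)
Definition admissible u : Prop := [/\ u.[0] = 0, u.[1] = 0 &
  forall t, t \in `[0, 1] -> 0 < 1 + u^`().[t]].

(** The fractional part of [x]. *)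
Definition fracpart x : R := x - (Num.floor x)%:~R.

Lemma fracpart_itv x : 0 <= fracpart x < 1.
Proof.
rewrite /fracpart; have := floor_le x; have := floorD1_gt x; rewrite intrD.
by move=> ? ?; apply/andP; split; lra.
Qed.

Lemma fracpart_in x : fracpart x \in `[0, 1].
Proof. by have /andP[x0 x1] := fracpart_itv x; rewrite in_itv/= x0 ltW. Qed.

(** The map x |-> x + u(x) of the unit interval, extended so as to commute with
    the translation by 1. *)
Definition periodic_map u x : R := x + u.[fracpart x].

Lemma periodic_mapE u k t : admissible u -> t \in `[0, 1] ->
  periodic_map u (k%:~R + t) = k%:~R + (t + u.[t]).
Proof.
move=> [u0 u1 _]; rewrite in_itv/= => /andP[t0]; rewrite le_eqVlt.
case/predU1P => [->|t1]; rewrite /periodic_map /fracpart.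
  by rewrite -(intrD _ k 1) intrKfloor subrr u0 u1 !addr0 intrD.
have -> : Num.floor (k%:~R + t) = k.
  apply/eqP; rewrite floor_eq; apply/andP.
  by split; rewrite ?intrD ?lerDl ?ltrD2l.
by rewrite [k%:~R + t]addrC addrK addrCA addrA.
Qed.

Lemma smooth_displacement u : smooth_in `[0, 1] (fun t => t + u.[t]).
Proof.
apply: eq_smooth_in (@smooth_in_horner _ _ _ ltr01 ('X + u)) => t _.
by rewrite hornerD hornerX.
Qed.

Lemma is_der_displacement (A : set R) u t :
  is_der_in A (fun t => t + u.[t]) t (1 + u^`().[t]).
Proof.
apply: is_der_inD; first exact: is_der_in_id.
exact: is_der_in_horner.
Qed.

Lemma displacement_incr u : admissible u ->
  {in `[0, 1] &, {homo (fun t => t + u.[t]) : x y / x < y}}.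
Proof.
move=> [_ _ u'0]; apply: (derive_gt0_homo (f' := fun t => 1 + u^`().[t])).
by move=> t tI; split; [exact: is_der_displacement|exact: u'0].
Qed.

Lemma displacement_diffeo u : admissible u ->
  incr_diffeo 0 1 (fun t => t + u.[t]).
Proof.
move=> ua; have [_ _ u'0] := ua; split => //; first exact: displacement_incr.
  exact: smooth_displacement.
move=> t tI; rewrite (derive_in_val ltr01 tI (@is_der_displacement _ u t)).
exact: u'0.
Qed.

Lemma displacement_itv u t : admissible u -> t \in `[0, 1] ->
  t + u.[t] \in `[0, 1].
Proof.
move=> ua tI; have := incr_diffeo_image (displacement_diffeo ua) tI.
by have [-> -> _] := ua; rewrite !addr0.
Qed.

Lemma fracpartK x : x = (Num.floor x)%:~R + fracpart x.
Proof. by rewrite /fracpart addrC subrK. Qed.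

Lemma periodic_mapD1 u x : periodic_map u (x + 1) = periodic_map u x + 1.
Proof.
have fx : Num.floor (x + 1) = Num.floor x + 1 by rewrite floorDrz ?floor1.
by rewrite /periodic_map /fracpart fx intrD opprD addrACA subrr addr0 addrAC.
Qed.

Lemma periodic_map_homo u : admissible u -> {homo periodic_map u : x y / x < y}.
Proof.
move=> ua x y xy; have [u0 u1 _] := ua.
have lt1 t : 0 <= t < 1 -> t + u.[t] < 1.
  move=> /andP[t0 t1]; have tI : t \in `[0, 1] by rewrite in_itv/= t0 ltW.
  have I1 : 1 \in `[0 : R, 1] by rewrite bound_itvE.
  by have := displacement_incr ua tI I1 t1; rewrite /= u1 addr0.
rewrite [in ltLHS](fracpartK x) [in ltRHS](fracpartK y).
rewrite !periodic_mapE ?fracpart_in//.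
have [xy'|xy'|fxy] := ltgtP (Num.floor x) (Num.floor y).
- have := displacement_itv ua (fracpart_in y); rewrite in_itv/= => /andP[h _].
  have h' := lt1 _ (fracpart_itv x).
  have : (Num.floor x + 1)%:~R <= (Num.floor y)%:~R :> R.
    by rewrite ler_int lezD1.
  rewrite intrD => h''.
  rewrite (@lt_le_trans _ _ ((Num.floor x)%:~R + 1)) ?ltrD2l//.
  by rewrite (le_trans h'')// lerDl.
- by move: xy'; rewrite ltNge le_floor// ltW.
- have fxyI : fracpart x < fracpart y by rewrite /fracpart fxy ltrD2r.
  rewrite fxy ltrD2l.
  exact: (displacement_incr ua (fracpart_in x) (fracpart_in y) fxyI).
Qed.

Lemma periodic_map_surj u : admissible u -> exists G, cancel G (periodic_map u).
Proof.
move=> ua; have [u0 u1 _] := ua.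
suff H y : exists x, periodic_map u x = y by have [G GK] := choice H; exists G.
have [t tI ty] : exists2 t, t \in `[0, 1] & t + u.[t] = fracpart y.
  have fc := smooth_in_continuous (@smooth_displacement u).
  have [|t tI ty] := IVT ler01 fc (v := fracpart y); last by exists t.
  rewrite u0 u1 !addr0 min_l// max_r//.
  by have := fracpart_in y; rewrite in_itv.
by exists ((Num.floor y)%:~R + t); rewrite periodic_mapE// ty -fracpartK.
Qed.

Local Notation N := (n%:R : R).

Lemma N_gt0 : 0 < N. Proof. by rewrite ltr0n. Qed.
Lemma N_neq0 : N != 0. Proof. by rewrite pnatr_eq0 -lt0n. Qed.
Local Hint Resolve N_gt0 N_neq0 : core.

(** The same map copied on each of the arcs [i / n, (i + 1) / n]. *)
Definition poly_lift u x : R := periodic_map u (N * x) / N.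

Lemma poly_lift_homo u : admissible u -> {homo poly_lift u : x y / x < y}.
Proof.
move=> ua x y xy; rewrite /poly_lift ltr_pM2r ?invr_gt0//.
by apply: periodic_map_homo => //; rewrite ltr_pM2l.
Qed.

Lemma poly_liftD1 u x : poly_lift u (x + 1) = poly_lift u x + 1.
Proof.
rewrite /poly_lift mulrDr mulr1.
rewrite (lift_intD (periodic_mapD1 u) _ n%:Z) mulrDl.
by rewrite divff.
Qed.

Lemma poly_lift_surj u : admissible u -> exists G, cancel G (poly_lift u).
Proof.
move=> /periodic_map_surj[G GK]; exists (fun y => G (N * y) / N) => y.
by rewrite /poly_lift [N * (_ / _)]mulrC divfK// GK mulrC mulKf.
Qed.

Lemma poly_liftE u k t : admissible u -> t \in `[0, 1] ->
  poly_lift u ((k%:~R + t) / N) = (k%:~R + (t + u.[t])) / N.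
Proof.
by move=> ua tI; rewrite /poly_lift [N * (_ / _)]mulrC divfK// periodic_mapE.
Qed.

(** The regular configuration (0, 1 / n, ..., (n - 1) / n). *)
Definition base_coord : 'rV[R]_n := \row_i (i%:R / N).
Definition base_conf : config R n := row_conf base_coord.

Lemma base_confE i : base_conf i = toS1 (i%:R / N).
Proof. by rewrite /base_conf /row_conf mxE. Qed.

Lemma base_conf_ordS i : base_conf (ordS i) = toS1 ((i%:R + 1) / N).
Proof.
rewrite base_confE /=; have := ltn_ord i; rewrite leq_eqVlt => /predU1P[iN|iN].
  rewrite iN modnn mul0r natr1 iN divff//.
  by rewrite -[1]add0r (toS1D 0 1).
by rewrite modn_small// natr1.
Qed.

Lemma Bconf_base : Bconf base_conf.
Proof.
exists (fun i => i%:R / N); split => [i|i j ij|i j].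
- by rewrite base_confE.
- by rewrite ltr_pM2r ?invr_gt0// ltr_nat.
- rewrite -ltrBlDl -mulrBl ltr_pdivrMr// mul1r.
  rewrite ltrBlDr (@lt_le_trans _ _ N) ?ltr_nat// ?ltn_ord// lerDl//.
Qed.

Lemma base_arc i : arc_of base_conf i (i%:R / N, (i%:R + 1) / N).
Proof.
split; rewrite ?base_conf_ordS ?base_confE//=.
rewrite ltr_pM2r ?invr_gt0// ltrDl ltr01/= mulrDl lerD2l.
by rewrite ler_pdivrMr// mul1r ler1n.
Qed.

(** The arrow from the regular configuration to itself with displacement [u] on
    every arc. *)
Definition poly_arrow u : arrow R n := (base_conf, circle_map (poly_lift u)).

Lemma poly_arrow_lift u : admissible u ->
  homeo (poly_arrow u).2 /\ is_lift (poly_arrow u).2 (poly_lift u).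
Proof.
move=> ua; have [G GK] := poly_lift_surj ua.
by apply: homeo_circle_map GK; [exact: poly_lift_homo|exact: poly_liftD1].
Qed.

Lemma poly_arrowE u x : (poly_arrow u).2 (toS1 x) = toS1 (poly_lift u x).
Proof. by rewrite /poly_arrow/= circle_mapE//; exact: poly_liftD1. Qed.

(** The affine bijection of the [i]-th arc onto the unit interval. *)
Definition arc_chart i x : R := N * x + - i%:R.

Lemma arc_chart0 i : arc_chart i (i%:R / N) = 0.
Proof. by rewrite /arc_chart mulrC divfK// subrr. Qed.

Lemma arc_chart1 i : arc_chart i ((i%:R + 1) / N) = 1.
Proof. by rewrite /arc_chart mulrC divfK// addrAC subrr add0r. Qed.

Lemma arc_chart_itv i x : x \in `[i%:R / N, (i%:R + 1) / N] ->
  arc_chart i x \in `[0, 1].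
Proof.
rewrite /arc_chart !in_itv/= ler_pdivrMr// ler_pdivlMr// mulrC => /andP[ix xi].
by rewrite subr_ge0 ix lerBlDl.
Qed.

Lemma poly_lift_chart u i x : admissible u ->
  x \in `[i%:R / N, (i%:R + 1) / N] ->
  poly_lift u x = (i%:R + (arc_chart i x + u.[arc_chart i x])) / N.
Proof.
move=> ua xi; rewrite -(@poly_liftE u i)//; last exact: arc_chart_itv.
by rewrite /arc_chart addrC subrK mulrC mulKf.
Qed.

Lemma poly_lift_diffeo u i : admissible u ->
  incr_diffeo (i%:R / N) ((i%:R + 1) / N) (poly_lift u).
Proof.
move=> ua; apply: diffeo_on_incr.
- exact: arc_lt (base_arc i).
- by move=> x y; exact: poly_lift_homo.
pose f t := t + u.[t]; pose h y := N^-1 * y + i%:R / N.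
apply: (eq_diffeo_on (arc_lt (base_arc i)) (f := h \o (f \o arc_chart i))).
  move=> x xi; rewrite (poly_lift_chart ua xi) /h /=.
  by rewrite mulrC -mulrDl addrC.
have [u0 u1 _] := ua.
have f0 : f 0 = 0 by rewrite /f u0 addr0.
have f1 : f 1 = 1 by rewrite /f u1 addr0.
have hlt x y : x < y -> h x < h y.
  by move=> xy; rewrite ltrD2r ltr_pM2l ?invr_gt0.
apply: diffeo_on_comp; rewrite /= ?arc_chart0 ?arc_chart1 ?f0 ?f1 ?hlt//.
- exact: arc_lt (base_arc i).
- apply: diffeo_on_comp; rewrite ?arc_chart0 ?arc_chart1 ?f0 ?f1//.
  + exact: arc_lt (base_arc i).
  + by apply: diffeo_on_affine => //; exact: arc_lt (base_arc i).
  + exact: incr_diffeo_on (displacement_diffeo ua).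
- by apply: diffeo_on_affine => //; rewrite invr_gt0.
Qed.

Lemma BDiff_poly_arrow u : admissible u -> BDiff (poly_arrow u).
Proof.
move=> ua; have [uh ul] := poly_arrow_lift ua.
apply: (@BDiffI _ _ (poly_arrow u) _ Bconf_base uh ul) => i s t st.
have [k [-> ->]] := arc_lift_unique (base_arc i) st.
have ud := poly_lift_diffeo i ua; have [ab _ _ _] := ud.
have := @diffeo_on_shift R _ _ _ k%:~R k%:~R ab (incr_diffeo_lt ud)
  (incr_diffeo_on ud).
apply: eq_diffeo_on; first by rewrite ltrD2r.
by move=> x _; rewrite -[in RHS](subrK k%:~R x) (lift_intD (poly_liftD1 u)).
Qed.

Lemma trg_poly_arrow u : admissible u -> trg (poly_arrow u) = base_conf.
Proof.
move=> ua; apply/funext => i; rewrite /trg /= -/(poly_arrow u).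
rewrite base_confE -[circle_map _]/((poly_arrow u).2) poly_arrowE.
have := @poly_liftE u i 0 ua; rewrite addr0 add0r => ->; last first.
  by rewrite bound_itvE.
by have [-> _ _] := ua; rewrite addr0.
Qed.

(** The coordinates of an isotropy arrow of the regular configuration with
    displacement [w]. *)
Definition poly_coords w : coords R n :=
  (base_coord, base_coord, disp_poly n w).

Lemma poly_coords_dom w : admissible w -> coords_dom (poly_coords w).
Proof.
move=> wa; split => [||i]; [exact: Bconf_base|exact: Bconf_base|].
apply: (eq_diffeo_on ltr01 _ (incr_diffeo_on (displacement_diffeo wa))).
by move=> t tI; have [w0 w1 _] := wa; rewrite [X in _ = _ + X]disp_polyE.
Qed.

Lemma arc_pt_base i t : arc_pt (base_conf i) (base_conf (ordS i)) t =
  toS1 ((i%:R + t) / N).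
Proof.
rewrite /arc_pt; have [k ->] := arc_lift_unique (base_arc i) (arc_liftP _ _).
rewrite -(toS1D ((i%:R + t) / N) k) /=; congr toS1.
rewrite (_ : (i%:R + 1) / N + k%:~R - (i%:R / N + k%:~R) = N^-1).
  by rewrite addrAC -mulrDl.
by rewrite opprD addrACA subrr addr0 -mulrBl addrAC subrr add0r div1r.
Qed.

(** Whatever lift of the arc [arc_pt] uses, it is a translate of
    [i / n, (i + 1) / n] by an integer. *)
Lemma has_poly_coords (a : arrow R n) w :
  src a = base_conf -> trg a = base_conf ->
  w.[0] = 0 -> w.[1] = 0 ->
  (forall i t, t \in `[0, 1] ->
    a.2 (toS1 ((i%:R + t) / N)) = toS1 ((i%:R + (t + w.[t])) / N)) ->
  has_coords a (poly_coords w).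
Proof.
move=> sa ta w0 w1 aw; split => // i t tI.
rewrite sa ta !arc_pt_base -[(poly_coords w).2]/(disp_poly n w) disp_polyE//.
exact: aw.
Qed.

(** The displacement of (id + u) o (id + v). *)
Definition comp_disp u v : {poly R} := v + (u \Po ('X + v)).

Lemma comp_dispE u v t : (comp_disp u v).[t] = v.[t] + u.[t + v.[t]].
Proof. by rewrite /comp_disp hornerD horner_comp hornerD hornerX. Qed.

Lemma bcomp_poly_coords u v : admissible u -> admissible v ->
  has_coords (bcomp (poly_arrow u) (poly_arrow v))
    (poly_coords (comp_disp u v)).
Proof.
move=> ua va; have [[u0 u1 _] [v0 v1 _]] := (ua, va).
apply: has_poly_coords => //.
- have uv : src (poly_arrow u) = trg (poly_arrow v).
    exact: esym (trg_poly_arrow va).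
  exact: etrans (trg_bcomp uv) (trg_poly_arrow ua).
- by rewrite comp_dispE v0 add0r addr0.
- by rewrite comp_dispE v1 add0r addr0.
- move=> i t tI; rewrite /bcomp [LHS]/=.
  rewrite -[circle_map (poly_lift v)]/((poly_arrow v).2).
  rewrite poly_arrowE (@poly_liftE v i)//.
  rewrite -[circle_map (poly_lift u)]/((poly_arrow u).2) poly_arrowE.
  rewrite (@poly_liftE u i) ?displacement_itv// comp_dispE.
  by rewrite [t + (_ + _)]addrA.
Qed.

End Polynomial_arrows.

(** * The cocycle on polynomial arrows *)

Section Chi_of_polynomial_arrows.
Context {R : realType} (n : nat) (n0 : (0 < n)%N).
Implicit Types (p u v w X Y I J : {poly R}) (x y t e : R) (i : 'I_n).
Local Notation mu := (@lebesgue_measure R).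
Local Notation N := (n%:R : R).

Let N_gt0 : 0 < N. Proof. by rewrite ltr0n. Qed.
Let N_neq0 : N != 0. Proof. by rewrite pnatr_eq0 -lt0n. Qed.

(** log phi_x o psi for the displacements [u] of phi and [v] of psi. *)
Definition displaced_log_derive u v y : R := ln (1 + u^`().[y + v.[y]]).
(** The derivative of log psi_x for the displacement [v] of psi. *)
Definition log_second_derive v y : R := (1 + v^`().[y])^-1 * v^`()^`().[y].

Lemma is_der_arc_chart (A : set R) i x : is_der_in A (@arc_chart R n i) x N.
Proof.
have := is_der_inD (is_der_inM (is_der_in_cst A N x) (is_der_in_id A x))
  (is_der_in_cst A (- i%:R) x).
by rewrite mul0r add0r mulr1 addr0.
Qed.

Lemma is_der_one_plus (A : set R) p y :
  is_der_in A (fun z => 1 + p.[z]) y p^`().[y].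
Proof.
have := is_der_inD (is_der_in_cst A 1 y) (@is_der_in_horner R A p y).
by rewrite add0r.
Qed.

Lemma is_der_log_derive (A : set R) v y : A y -> 0 < 1 + v^`().[y] ->
  is_der_in A (fun z => ln (1 + v^`().[z])) y (log_second_derive v y).
Proof.
move=> Ay v0.
exact: (@is_der_in_lnf R A (fun z => 1 + v^`().[z]) y _ Ay v0
  (@is_der_one_plus A _ y)).
Qed.

Lemma derive_in_poly_lift u i x : admissible u ->
  `[i%:R / N, (i%:R + 1) / N]%classic x ->
  derive_in `[i%:R / N, (i%:R + 1) / N] (poly_lift n u) x =
  1 + u^`().[arc_chart i x].
Proof.
move=> ua xi; apply: (derive_in_val (arc_lt (base_arc n0 i)) xi).
set A := `[_, _]%classic in xi *.
have H1 := is_der_in_comp (fun y (_ : A y) => I : setT _) xi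
  (@is_der_displacement R setT u (arc_chart i x)) (is_der_arc_chart A i x).
have H2 := is_der_inM (is_der_inD (is_der_in_cst A i%:R x) H1)
  (is_der_in_cst A N^-1 x).
rewrite add0r mulr0 addr0 mulfK// in H2.
apply: is_der_in_eq H2 => // y /[!inE] yi.
by rewrite (poly_lift_chart n0 ua yi).
Qed.

Lemma displaced_log_derive_continuous u v : admissible u -> admissible v ->
  {within `[0, 1], continuous (displaced_log_derive u v)}.
Proof.
move=> [_ _ u0] va; apply: smooth_in_continuous.
apply: (smooth_in_ln ltr01) => [y yI|].
  by apply: u0; exact: displacement_itv.
apply: eq_smooth_in (@smooth_in_horner R _ _ ltr01 (1 + (u^`() \Po ('X + v)))).
by move=> y _; rewrite !hornerE horner_comp !hornerE.
Qed.

Lemma log_second_derive_continuous v : admissible v ->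
  {within `[0, 1], continuous (log_second_derive v)}.
Proof.
move=> [_ _ v0].
have s : smooth_in `[0 : R, 1] (fun y => ln (1 + v^`().[y])).
  apply: (smooth_in_ln ltr01) => [y yI|]; first exact: v0.
  apply: eq_smooth_in (@smooth_in_horner R _ _ ltr01 (1 + v^`())).
  by move=> y _; rewrite !hornerE.
apply: smooth_in_continuous; apply: eq_smooth_in (smooth_in_derive s).
move=> y /[!inE] yI; apply: (derive_in_val ltr01 yI).
exact: is_der_log_derive yI (v0 _ yI).
Qed.

(** Each arc of the regular configuration contributes the same integral over the
    unit interval. *)
Lemma chi_poly_arrow u v i : admissible u -> admissible v ->
  chi (poly_arrow n u) (poly_arrow n v) 0 i =
  \int[mu]_(y in `[0, 1])
    (displaced_log_derive u v y * log_second_derive v y).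
Proof.
move=> ua va; have [_ ul] := poly_arrow_lift n0 ua.
have [_ vl] := poly_arrow_lift n0 va.
have uv : src (poly_arrow n u) = trg (poly_arrow n v).
  exact: esym (trg_poly_arrow n0 va).
apply: (etrans (chi_lift (BDiff_poly_arrow n0 ua) (BDiff_poly_arrow n0 va) uv
  ul vl (base_arc n0 i))).
have ab : i%:R / N < (i%:R + 1) / N := arc_lt (base_arc n0 i).
have [v0 v1 v'0] := va.
have Ga : poly_lift n v (i%:R / N) = i%:R / N.
  have := @poly_liftE R n n0 v i 0 va; rewrite bound_itvE => /(_ ler01).
  by rewrite v0 !addr0.
have Gb : poly_lift n v ((i%:R + 1) / N) = (i%:R + 1) / N.
  have := @poly_liftE R n n0 v i 1 va; rewrite bound_itvE => /(_ ler01).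
  by rewrite v1 !addr0.
rewrite log_int.unlock Ga Gb.
set A := `[i%:R / N, (i%:R + 1) / N]%classic.
pose K y := displaced_log_derive u v y * log_second_derive v y.
have Kc : {within `[0, 1], continuous K}.
  apply/subspace_continuousP => y yI; apply: cvgM.
    have /subspace_continuousP := displaced_log_derive_continuous ua va; exact.
  have /subspace_continuousP := log_second_derive_continuous va; exact.
have chartI x : A x -> `[0, 1]%classic (arc_chart i x).
  by move=> xi; exact: arc_chart_itv.
have Gchart x : A x -> arc_chart i (poly_lift n v x) =
    arc_chart i x + v.[arc_chart i x].
  move=> xi; rewrite {1}/arc_chart (poly_lift_chart n0 va xi).
  by rewrite [N * _]mulrC divfK// addrAC subrr add0r.
have vd := poly_lift_diffeo n0 i va.
have E x : x \in A -> ln (derive_in A (poly_lift n u) (poly_lift n v x)) *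
    derive_in A (fun z => ln (derive_in A (poly_lift n v) z)) x =
    K (arc_chart i x) * N.
  move=> /[!inE] xi; rewrite derive_in_poly_lift//; last first.
    by have := incr_diffeo_image vd xi; rewrite Ga Gb.
  rewrite Gchart// /K -mulrA /displaced_log_derive; congr (_ * _).
  apply: (derive_in_val ab xi).
  have H := is_der_in_comp (B := `[0, 1]%classic) chartI xi
    (is_der_log_derive (chartI x xi) (v'0 _ (chartI x xi)))
    (is_der_arc_chart A i x).
  apply: is_der_in_eq H => // z /[!inE] zi.
  by rewrite /= derive_in_poly_lift.
have chart_homo : {in `[i%:R / N, (i%:R + 1) / N] &,
    {homo arc_chart (n:=n) i : x y / x < y}}.
  by move=> x y _ _ xy; rewrite /arc_chart ltrD2r ltr_pM2l.
have Nc : {within A, continuous (fun=> N)}.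
  by apply/subspace_continuousP => x _; exact: cvg_cst.
have := Rintegral_substitution (K := K) ab chart_homo
  (fun x _ => is_der_arc_chart A i x) Nc.
rewrite arc_chart0// arc_chart1// => /(_ Kc) S.
exact: etrans (eq_Rintegral mu E) (esym S).
Qed.

Lemma poly_FTC I : \int[mu]_(y in `[0, 1]) I^`().[y] = I.[1] - I.[0].
Proof.
have Ic p : {within `[0, 1], continuous (fun x => p.[x])}.
  exact: smooth_in_continuous (@smooth_in_horner R _ _ ltr01 p).
have /(continuous_within_itvP _ ltr01)[_ I0 I1] := Ic I.
have Id (x : R) : is_derive x 1 (horner I) I^`().[x] by exact: is_derive_poly.
rewrite /Rintegral (@continuous_FTC2 _ _ (horner I) _ _ ltr01 (Ic _))//.
  by split=> // x _; have [] := Id x.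
by move=> x _; rewrite derive1E; have [_ ->] := Id x.
Qed.

End Chi_of_polynomial_arrows.

Section Expansion_of_chi.
Context {R : realType} (n : nat) (n0 : (0 < n)%N).
Implicit Types (p u v w X Y I J : {poly R}) (x y t e : R) (i : 'I_n).
Local Notation mu := (@lebesgue_measure R).

Lemma ln1p_bound (s : R) : `|s| <= 2^-1 -> `|ln (1 + s) - s| <= 2 * s ^+ 2.
Proof.
rewrite ler_norml => /andP[s1 s2]; have s0 : 0 < 1 + s by lra.
have up : ln (1 + s) <= s by apply: le_ln1Dx; lra.
have lo : s / (1 + s) <= ln (1 + s).
  have zE : 1 + - (s / (1 + s)) = (1 + s)^-1.
    by field; rewrite gt_eqF.
  have := @le_ln1Dx R (- (s / (1 + s))); rewrite zE lnV ?posrE// lerN2; apply.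
  by rewrite -subr_gt0 opprK addrC zE invr_gt0.
have sE : s / (1 + s) = s - s ^+ 2 / (1 + s) by field; rewrite gt_eqF.
have sq : s ^+ 2 / (1 + s) <= 2 * s ^+ 2.
  rewrite ler_pdivrMr//; have := sqr_ge0 s; nra.
have := sqr_ge0 s; rewrite ler_norml => sq0; apply/andP; split; lra.
Qed.

Lemma inv1p_bound (s : R) : `|s| <= 2^-1 -> `|(1 + s)^-1 - 1| <= 2 * `|s|.
Proof.
move=> s12; move: (s12); rewrite ler_norml => /andP[s1 s2].
have s0 : 0 < 1 + s by lra.
have -> : (1 + s)^-1 - 1 = - s / (1 + s) by field; rewrite gt_eqF.
rewrite normrM normrN normfV (gtr0_norm s0) ler_pdivrMr//.
by have := normr_ge0 s; nra.
Qed.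

(** The constant of [integrand_bound], where [M] bounds the functions involved
    and [L * e] the change of X' under the displacement. *)
Definition expansion_const (M L : R) : R :=
  M * (L + 2 * M ^+ 2 + (M + 2 * M ^+ 2) * (2 * M)).

(** With b = X'(y + e Y(y)), a = X'(y), y1 = Y'(y), y2 = Y''(y), this bounds the
    error in replacing the integrand of [chi] by e^2 X' Y''. *)
Lemma integrand_bound (M L e a b y1 y2 : R) : 0 < M -> 0 < e -> e <= 1 ->
  e * M <= 2^-1 -> `|b| <= M -> `|b - a| <= L * e -> `|y1| <= M -> `|y2| <= M ->
  `|ln (1 + e * b) * ((1 + e * y1)^-1 * (e * y2)) - e ^+ 2 * (a * y2)| <=
  e ^+ 3 * expansion_const M L.
Proof.
move=> M0 e0 e1 eM bM baL y1M y2M.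
have eb : `|e * b| <= e * M by rewrite normrM gtr0_norm// ler_pM2l.
have ey1 : `|e * y1| <= e * M by rewrite normrM gtr0_norm// ler_pM2l.
set r := ln (1 + e * b) - e * b; set s := (1 + e * y1)^-1 - 1.
have rM : `|r| <= 2 * e ^+ 2 * M ^+ 2.
  rewrite (le_trans (ln1p_bound (le_trans eb eM)))// -mulrA ler_pM2l//.
  rewrite -exprMn -[leLHS]real_normK ?num_real// ler_sqr ?nnegrE//.
  by rewrite mulr_ge0// ltW.
have sM : `|s| <= 2 * (e * M).
  by rewrite (le_trans (inv1p_bound (le_trans ey1 eM)))// ler_pM2l.
have -> : ln (1 + e * b) * ((1 + e * y1)^-1 * (e * y2)) - e ^+ 2 * (a * y2) =
    e * y2 * (e * (b - a) + r + (e * b + r) * s) by rewrite /r /s; ring.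
have ebr : `|e * b + r| <= e * (M + 2 * M ^+ 2).
  rewrite (le_trans (ler_normD _ _))// mulrDr lerD// (le_trans rM)//.
  have -> : 2 * e ^+ 2 * M ^+ 2 = e * (2 * M ^+ 2) * e by ring.
  by rewrite ler_piMr// !mulr_ge0 ?sqr_ge0 ?ltW.
have ebas : `|e * (b - a) + r + (e * b + r) * s| <=
    e ^+ 2 * (L + 2 * M ^+ 2 + (M + 2 * M ^+ 2) * (2 * M)).
  have -> : e ^+ 2 * (L + 2 * M ^+ 2 + (M + 2 * M ^+ 2) * (2 * M)) =
    (e * (L * e) + 2 * e ^+ 2 * M ^+ 2) +
    (e * (M + 2 * M ^+ 2)) * (2 * (e * M)) by ring.
  rewrite (le_trans (ler_normD _ _))// lerD//.
    rewrite (le_trans (ler_normD _ _))// lerD//.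
    by rewrite normrM gtr0_norm// ler_pM2l.
  by rewrite normrM; exact: ler_pM.
rewrite normrM (_ : e ^+ 3 * _ = (e * M) * (e ^+ 2 * (L + 2 * M ^+ 2 +
  (M + 2 * M ^+ 2) * (2 * M)))); last by rewrite /expansion_const; ring.
by apply: ler_pM => //; rewrite normrM gtr0_norm// ler_pM2l.
Qed.

Lemma poly_lipschitz p : exists2 L, 0 < L & forall x y, x \in `[0, 1] ->
  y \in `[0, 1] -> `|p.[y] - p.[x]| <= L * `|y - x|.
Proof.
elim/poly_ind: p => [|p c [L L0 IH]].
  by exists 1 => // x y _ _; rewrite !horner0 subrr normr0 mul1r.
have [C C0 pC] := poly_bounded p.
exists (L + C) => [|x y xI yI]; first exact: addr_gt0.
rewrite !hornerMXaddC (_ : _ - _ = (p.[y] - p.[x]) * y + p.[x] * (y - x)).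
  rewrite (le_trans (ler_normD _ _))// [leRHS]mulrDl !normrM lerD//.
    rewrite -[leRHS]mulr1 ler_pM// ?IH// ger0_norm; last by rewrite (itvP yI).
    by rewrite (itvP yI).
  by rewrite ler_wpM2r// pC.
by ring.
Qed.

Lemma admissibleZ X : X.[0] = 0 -> X.[1] = 0 -> exists2 e0, 0 < e0 &
  forall e, 0 < e < e0 -> admissible (e *: X).
Proof.
move=> X0 X1; have [M M0 XM] := poly_bounded X^`().
exists M^-1; first by rewrite invr_gt0.
move=> e /andP[e0 eM]; split; rewrite ?hornerZ ?X0 ?X1 ?mulr0// => t tI.
rewrite derivZ hornerZ.
have : `|e * X^`().[t]| < 1.
  rewrite normrM gtr0_norm// (@le_lt_trans _ _ (e * M))//.
    by rewrite ler_pM2l// XM.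
  by rewrite -ltr_pdivlMr// mul1r.
by rewrite ltr_norml => /andP[h _]; rewrite -ltrBlDl sub0r.
Qed.

(** Here [I] is a primitive of X' Y'', so that the leading term is
    e^2 times the integral of X' Y'' over the unit interval. *)
Lemma chi_expansion X Y I i :
  X.[0] = 0 -> X.[1] = 0 -> Y.[0] = 0 -> Y.[1] = 0 ->
  I^`() = X^`() * Y^`()^`() ->
  exists C, exists2 e0, 0 < e0 & forall e, 0 < e < e0 ->
    `|chi (poly_arrow n (e *: X)) (poly_arrow n (e *: Y)) 0 i -
      e ^+ 2 * (I.[1] - I.[0])| <= C * e ^+ 3.
Proof.
move=> X0 X1 Y0 Y1 IE.
have [eX eX0 Xa] := admissibleZ X0 X1; have [eY eY0 Ya] := admissibleZ Y0 Y1.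
have [M1 M10 X'M] := poly_bounded X^`().
have [M2 M20 YM] := poly_bounded Y.
have [M3 M30 Y'M] := poly_bounded Y^`().
have [M4 M40 Y''M] := poly_bounded Y^`()^`().
have [L L0 X'L] := poly_lipschitz X^`().
pose M := M1 + M2 + M3 + M4.
have M0 : 0 < M by rewrite !addr_gt0.
pose C := expansion_const M (L * M).
exists C; exists (Num.min (Num.min eX eY) (Num.min 1 (2 * M)^-1)).
  by rewrite !lt_min eX0 eY0 ltr01 invr_gt0 mulr_gt0.
move=> e /andP[e0]; rewrite !lt_min => /andP[/andP[eeX eeY] /andP[e1 eM]].
have ua : admissible (e *: X) by apply: Xa; rewrite e0.
have va : admissible (e *: Y) by apply: Ya; rewrite e0.
have eM2 : e * M <= 2^-1.
  have : e * (2 * M) < 1 by rewrite -ltr_pdivlMr ?mulr_gt0// mul1r.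
  by move=> h; lra.
rewrite (chi_poly_arrow n0 i ua va).
pose K y := displaced_log_derive (e *: X) (e *: Y) y *
  log_second_derive (e *: Y) y.
have bound y : y \in `[0, 1] ->
    `|K y - e ^+ 2 * I^`().[y]| <= e ^+ 3 * C.
  move=> yI; rewrite /K /displaced_log_derive /log_second_derive IE.
  rewrite !derivZ !(hornerZ, hornerM).
  have yI' : y + e * Y.[y] \in `[0, 1].
    by have := displacement_itv va yI; rewrite hornerZ.
  apply: integrand_bound => //; first exact: ltW.
  - by rewrite (le_trans (X'M _ yI'))// /M -!addrA lerDl !addr_ge0// ltW.
  - rewrite (le_trans (X'L _ _ yI yI'))// addrAC subrr add0r -mulrA ler_pM2l//.
    rewrite normrM gtr0_norm// mulrC ler_pM2r// (le_trans (YM _ yI))//.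
    by rewrite /M; lra.
  - by rewrite (le_trans (Y'M _ yI))// /M; lra.
  - by rewrite (le_trans (Y''M _ yI))// /M; lra.
have Kc : {within `[0, 1], continuous K}.
  apply/subspace_continuousP => y yI; apply: cvgM.
    have /subspace_continuousP := displaced_log_derive_continuous ua va; exact.
  have /subspace_continuousP := log_second_derive_continuous va; exact.
(* The integrand lies between the derivatives of the polynomials P (- c) and
   P c with c = e^3 C, whose integrals are explicit. *)
pose P (c : R) : {poly R} := (e ^+ 2) *: I + c *: 'X.
have P'E c y : (P c)^`().[y] = e ^+ 2 * I^`().[y] + c.
  by rewrite /P derivD !derivZ derivX !hornerE.
have PI c : \int[mu]_(y in `[0, 1]) (P c)^`().[y] =
    e ^+ 2 * (I.[1] - I.[0]) + c.
  by rewrite poly_FTC /P !hornerE; ring.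
have Pint c : mu.-integrable `[0, 1] (EFin \o (fun y => (P c)^`().[y])).
  apply: segment_integrable.
  exact: smooth_in_continuous (@smooth_in_horner _ _ _ ltr01 _).
rewrite [C * _]mulrC ler_norml; apply/andP; split.
- rewrite lerBrDl -(PI (- (e ^+ 3 * C))); apply: le_Rintegral => //.
    exact: segment_integrable.
  move=> y yI; rewrite P'E; have := bound y yI; rewrite ler_norml => /andP[h _].
  by rewrite -lerBrDl.
- rewrite lerBlDl -(PI (e ^+ 3 * C)); apply: le_Rintegral => //.
    exact: segment_integrable.
  move=> y yI; rewrite P'E; have := bound y yI; rewrite ler_norml => /andP[_ h].
  by rewrite -lerBlDl.
Qed.

End Expansion_of_chi.

(** * Nontriviality *)

Section Directional_mean_value.
Context {R : realType} (n : nat).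

(** Mean value theorem for one component of a map with directional derivatives,
    along the segment from [c] to [c + a *: v]. *)
Lemma dir_MVT (E : tvsType R) (g : E -> 'rV[R]_n) (dg : E * E -> 'rV[R]_n)
    (c v : E) (a : R) (i : 'I_n) : 0 < a ->
  (forall t, t \in `[0, a] ->
    has_dir_derivative g (c + t *: v) v (dg (c + t *: v, v))) ->
  exists2 t, t \in `[0, a] &
    g (c + a *: v) 0 i - g c 0 i = a * dg (c + t *: v, v) 0 i.
Proof.
move=> a0 gd; pose T (t : R) := g (c + t *: v) 0 i.
have Td t : t \in `[0, a] -> is_derive t 1 T (dg (c + t *: v, v) 0 i).
  move=> /gd gt.
  have H : (fun h : R => h^-1 *: ((T \o shift t) (h *: (1 : R)) - T t)) @ 0^'
      --> dg (c + t *: v, v) 0 i.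
    have Hc := cvg_comp _ _ gt (@coord_continuous R 1 n 0 i _).
    apply: cvg_trans Hc; apply: near_eq_cvg; apply: nearW => h /=.
    rewrite !mxE /T /shift/= [h *: 1]mulr1; congr (_ * (g _ 0 i - _)).
    by rewrite (addrC h) scalerDl addrA.
  apply: DeriveDef; first by apply/cvg_ex; eexists; exact: H.
  by apply: cvg_lim => //; exact: H.
have Tc : {within `[0, a], continuous T}.
  apply/subspace_continuousP => t tI; apply: cvg_within_filter.
  have [Tdt _] := Td t tI.
  exact/differentiable_continuous/derivable1_diffP.
have Td' t : t \in `]0, a[ -> is_derive t 1 T (dg (c + t *: v, v) 0 i).
  by move=> ta; apply: Td; exact: subset_itv_oo_cc.
have [t ta] := MVT a0 Td' Tc.
rewrite subr0 /T scale0r addr0 mulrC => TE; exists t; last exact: TE.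
exact: subset_itv_oo_cc.
Qed.

End Directional_mean_value.

Section Nontriviality.
Context {R : realType} (n : nat) (n0 : (0 < n)%N).
Implicit Types (p u v w X Y I J : {poly R}) (x y t e : R) (i : 'I_n).

Lemma disp_polyZ (a : R) p : disp_poly n (a *: p) = a *: disp_poly n p.
Proof.
have D0 : disp_poly n (0 : {poly R}) = 0.
  have := disp_poly_linear n 1 (0 : {poly R}) 0.
  by rewrite !scale1r addr0 -{1}[disp_poly n 0]addr0 => /addrI <-.
by rewrite -[_ *: p]addr0 disp_poly_linear D0 addr0.
Qed.

(** The tangent vector that moves only the displacement, along [v]. *)
Definition disp_direction v : coords R n := (0, 0, disp_poly n v).

Lemma poly_coordsD w v t : poly_coords n (w + t *: v) =
  poly_coords n w + t *: disp_direction v.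
Proof.
rewrite /poly_coords /disp_direction addrC disp_poly_linear.
rewrite -[RHS]/(_ + t *: 0, _ + t *: 0, _ + t *: disp_poly n v).
by rewrite !scaler0 !addr0 [_ + _ *: _]addrC.
Qed.

Lemma cvg_prod T (F : set_system T) (FF : Filter F) (S1 S2 : topologicalType)
    (f1 : T -> S1) (f2 : T -> S2) (a1 : S1) (a2 : S2) :
  f1 @ F --> a1 -> f2 @ F --> a2 -> (fun z => (f1 z, f2 z)) @ F --> (a1, a2).
Proof. by move=> fa1 fa2; exact: cvg_pair. Qed.

(** Continuity at (0, 0) of the point and the direction at which the mean value
    theorem evaluates the derivative; the two variables are the parameter e of
    the family and the position on the segment. *)
Lemma poly_family_cvg (A V : {poly {poly R}}) :
  (fun z : R * R => (poly_coords n (z.1 *: A.[z.1%:P] + z.2 *: V.[z.1%:P]),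
    disp_direction V.[z.1%:P])) @ ((0 : R), (0 : R)) -->
  (poly_coords n (0 *: A.[0%:P] + 0 *: V.[0%:P]), disp_direction V.[0%:P]).
Proof.
have c1 : (fun z : R * R => z.1) @ ((0 : R), (0 : R)) --> (0 : R).
  exact: cvg_fst.
have c2 : (fun z : R * R => z.2) @ ((0 : R), (0 : R)) --> (0 : R).
  exact: cvg_snd.
have Dc (W : {poly {poly R}}) : (fun z : R * R => disp_poly n W.[z.1%:P]) @
    ((0 : R), (0 : R)) --> disp_poly n W.[0%:P].
  exact: (cvg_comp _ _ c1 (@disp_poly_continuous R n W 0)).
have wE a b : disp_poly n (a *: A.[a%:P] + b *: V.[a%:P]) =
    a *: disp_poly n A.[a%:P] + b *: disp_poly n V.[a%:P].
  by rewrite disp_poly_linear disp_polyZ.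
have wc : (fun z : R * R =>
    disp_poly n (z.1 *: A.[z.1%:P] + z.2 *: V.[z.1%:P])) @
    ((0 : R), (0 : R)) --> disp_poly n (0 *: A.[0%:P] + 0 *: V.[0%:P]).
  rewrite wE [X in X @ _](_ : _ = fun z : R * R =>
    z.1 *: disp_poly n A.[z.1%:P] + z.2 *: disp_poly n V.[z.1%:P]); last first.
    by apply/funext => z; exact: wE.
  by apply: disp_cvgD; apply: disp_cvgZ => //; exact: Dc.
apply: cvg_prod; first by apply: cvg_prod; [exact: cvg_cst|exact: wc].
by apply: cvg_prod; [exact: cvg_cst|exact: Dc].
Qed.

(** [a], [b] are the values of f on two arrows, [g1], [g2] those on their two
    products; the sum a + b drops out of the antisymmetrized identity. *)
Lemma quadratic_part (e D dI dJ CI CJ g1 g2 a b : R) : 0 < e ->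
  g2 - g1 = e ^+ 2 * D ->
  `|a + b - g1 - e ^+ 2 * dI| <= CI * e ^+ 3 ->
  `|b + a - g2 - e ^+ 2 * dJ| <= CJ * e ^+ 3 ->
  `|D - (dI - dJ)| <= e * (CI + CJ).
Proof.
move=> e0 gD hI hJ; have e20 : 0 < e ^+ 2 by rewrite exprn_gt0.
rewrite -(ler_pM2l e20) -{1}(gtr0_norm e20) -normrM mulrBr -gD.
have -> : g2 - g1 - e ^+ 2 * (dI - dJ) =
  (a + b - g1 - e ^+ 2 * dI) - (b + a - g2 - e ^+ 2 * dJ) by ring.
rewrite (le_trans (ler_normB _ _))// (le_trans (lerD hI hJ))//.
by rewrite le_eqVlt; apply/orP; left; apply/eqP; ring.
Qed.

(** If [chi] is the coboundary of [f], read as [g] in coordinates with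
    directional derivative [dg], then the derivative of [g] at the identity
    along the bracket X Y' - Y X' is the integral of X' Y'' - Y' X'', computed
    with primitives [I] of X' Y'' and [J] of Y' X''. Only the continuity of [dg]
    at that point and direction is used. *)
Lemma coboundary_bracket X Y I J i (g : coords R n -> 'rV[R]_n)
    (dg : coords R n * coords R n -> 'rV[R]_n) (f : arrow R n -> 'rV[R]_n) :
  X.[0] = 0 -> X.[1] = 0 -> Y.[0] = 0 -> Y.[1] = 0 ->
  I^`() = X^`() * Y^`()^`() -> J^`() = Y^`() * X^`()^`() ->
  (forall c d, coords_dom c -> has_dir_derivative g c d (dg (c, d))) ->
  {for (poly_coords n 0, disp_direction (X * Y^`() - Y * X^`())),
    continuous dg} ->
  (forall a c, BDiff a -> coords_dom c -> has_coords a c -> f a = g c) ->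
  (forall phi psi, BDiff phi -> BDiff psi -> src phi = trg psi ->
    chi phi psi = f phi + f psi - f (bcomp phi psi)) ->
  dg (poly_coords n 0, disp_direction (X * Y^`() - Y * X^`())) 0 i =
  (I.[1] - I.[0]) - (J.[1] - J.[0]).
Proof.
move=> X0 X1 Y0 Y1 IE JE gd dgc fg fc.
set br := X * Y^`() - Y * X^`() in dgc *.
have [W1 W1E] := comp_poly_taylor X Y; have [W2 W2E] := comp_poly_taylor Y X.
(* The two products have displacements e A_e and e A_e + e^2 V_e, with V_0 the
   bracket. *)
pose A := (X + Y)%:P + (Y * X^`())%:P * 'X + W1 * 'X ^+ 2.
pose V := br%:P + (W2 - W1) * 'X.
have w1E e : comp_disp (e *: X) (e *: Y) = e *: A.[e%:P].
  rewrite /comp_disp comp_polyZ W1E /A !hornerE -!mul_polyC ?rmorphXn/=.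
  by ring.
have w2E e : comp_disp (e *: Y) (e *: X) = e *: A.[e%:P] + e ^+ 2 *: V.[e%:P].
  rewrite /comp_disp comp_polyZ W2E /A /V /br !hornerE -!mul_polyC ?rmorphXn/=.
  by ring.
have VE0 : V.[0%:P] = br by rewrite /V !hornerE.
clearbody A V.
have e2V e : e ^+ 2 *: V.[e%:P] =
    comp_disp (e *: Y) (e *: X) - comp_disp (e *: X) (e *: Y).
  by rewrite w2E w1E addrC addKr.
have end0 (z : R) p q e : p.[z] = 0 -> q.[z] = 0 ->
    (comp_disp (e *: p) (e *: q)).[z] = 0.
  by move=> pz qz; rewrite comp_dispE !hornerZ qz mulr0 addr0 add0r pz mulr0.
have A0 e z : X.[z] = 0 -> Y.[z] = 0 -> (e *: A.[e%:P]).[z] = 0.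
  by move=> Xz Yz; rewrite -w1E end0.
have V0 e z : 0 < e -> X.[z] = 0 -> Y.[z] = 0 -> (V.[e%:P]).[z] = 0.
  move=> e0 Xz Yz; have /(congr1 (horner^~ z)) := e2V e.
  rewrite hornerZ hornerD hornerN !end0// subrr => /eqP.
  by rewrite mulf_eq0 expf_eq0/= gt_eqF// => /eqP.
have [C1 C10 AC] := deriv_family_bounded A.
have [C2 C20 VC] := deriv_family_bounded V.
(* The whole segment between the two displacements is admissible. *)
have adm e t : 0 < e -> e < 1 -> e * (C1 + C2) < 1 -> t \in `[0, e ^+ 2] ->
    admissible (e *: A.[e%:P] + t *: V.[e%:P]).
  move=> e0 e1 eC; rewrite in_itv/= => /andP[t0 te].
  split; rewrite ?hornerD ?[(_ *: V.[_]).[_]]hornerZ ?A0 ?V0 ?mulr0 ?addr0//.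
  move=> s sI; rewrite derivD !derivZ hornerD !hornerZ.
  have ee : `|e| <= 1 by rewrite gtr0_norm// ltW.
  have te' : t <= e by rewrite (le_trans te)// expr2 ler_piMr// ltW.
  have b1 : `|e * (A.[e%:P])^`().[s]| <= e * C1.
    by rewrite normrM gtr0_norm// ler_pM2l// AC.
  have b2 : `|t * (V.[e%:P])^`().[s]| <= e * C2.
    by rewrite normrM ger0_norm// ler_pM// VC.
  move: b1 b2; rewrite !ler_norml => /andP[b1 _] /andP[b2 _].
  by rewrite mulrDr in eC; lra.
set d0 := dg _ 0 i; set om := _ - _.
have [CI [eI eI0 chiI]] := chi_expansion n0 i X0 X1 Y0 Y1 IE.
have [CJ [eJ eJ0 chiJ]] := chi_expansion n0 i Y0 Y1 X0 X1 JE.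
(* From here on [chi] matters only through the coboundary equation and its two
   expansions. *)
move: fc chiI chiJ; move: (@chi R n) => ch fc chiI chiJ.
have [eX eX0 Xa] := admissibleZ X0 X1; have [eY eY0 Ya] := admissibleZ Y0 Y1.
pose w (z : R * R) := (z.1 *: A.[z.1%:P] + z.2 *: V.[z.1%:P]).
pose Psi (z : R * R) := (poly_coords n (w z), disp_direction V.[z.1%:P]).
have PsiE : Psi (0, 0) = (poly_coords n 0, disp_direction br).
  by rewrite /Psi /w /= !scale0r addr0 VE0.
have Psic : Psi @ ((0 : R), (0 : R)) --> Psi (0, 0) := @poly_family_cvg A V.
(* The mean value theorem on the segment, for each small e. *)
have key e : 0 < e -> e < 1 -> e * (C1 + C2) < 1 -> e < eI -> e < eJ ->
    e < eX -> e < eY -> exists2 t, 0 <= t <= e ^+ 2 &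
    `|dg (Psi (e, t)) 0 i - om| <= e * (CI + CJ).
  move=> e0 e1 eC eeI eeJ eeX eeY.
  have ua : admissible (e *: X) by apply: Xa; rewrite e0.
  have va : admissible (e *: Y) by apply: Ya; rewrite e0.
  have uB := BDiff_poly_arrow n0 ua; have vB := BDiff_poly_arrow n0 va.
  have uv : src (poly_arrow n (e *: X)) = trg (poly_arrow n (e *: Y)).
    exact: esym (trg_poly_arrow n0 va).
  have vu : src (poly_arrow n (e *: Y)) = trg (poly_arrow n (e *: X)).
    exact: esym (trg_poly_arrow n0 ua).
  have gdt t : t \in `[0, e ^+ 2] -> has_dir_derivative g
      (poly_coords n (e *: A.[e%:P]) + t *: disp_direction V.[e%:P])
      (disp_direction V.[e%:P]) (dg (poly_coords n (e *: A.[e%:P]) +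
        t *: disp_direction V.[e%:P], disp_direction V.[e%:P])).
    move=> tI; apply: gd; rewrite -poly_coordsD.
    have H := adm e t e0 e1 eC tI.
    exact: (poly_coords_dom n0 H).
  have e20 : 0 < e ^+ 2 by rewrite exprn_gt0.
  have [t tI] := dir_MVT i e20 gdt.
  rewrite -!poly_coordsD -w2E => gE0.
  have gE : g (poly_coords n (comp_disp (e *: Y) (e *: X))) 0 i -
      g (poly_coords n (comp_disp (e *: X) (e *: Y))) 0 i =
      e ^+ 2 * dg (Psi (e, t)) 0 i by rewrite w1E.
  exists t; first by move: tI; rewrite in_itv.
  have fcomp u v : admissible u -> admissible v -> admissible (comp_disp u v) ->
      f (bcomp (poly_arrow n u) (poly_arrow n v)) =
      g (poly_coords n (comp_disp u v)).
    move=> {}ua {}va cuv; apply: fg; last exact: bcomp_poly_coords.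
      apply: BDiff_comp; [exact: BDiff_poly_arrow|exact: BDiff_poly_arrow|].
      exact: esym (trg_poly_arrow n0 va).
    exact: poly_coords_dom.
  have f1 := fcomp _ _ ua va; have f2 := fcomp _ _ va ua.
  have a1 : admissible (comp_disp (e *: X) (e *: Y)).
    rewrite w1E -[_ *: _]addr0 -[0](scale0r V.[e%:P]); apply: adm => //.
    by rewrite bound_itvE ltW.
  have a2 : admissible (comp_disp (e *: Y) (e *: X)).
    by rewrite w2E; apply: adm => //; rewrite bound_itvE ltW.
  have mxDB (a b c : 'rV[R]_n) : (a + b - c) 0 i = a 0 i + b 0 i - c 0 i.
    by rewrite !mxE.
  have cI := etrans (congr1 (fun M : 'rV[R]_n => M 0 i) (fc _ _ uB vB uv))
    (mxDB _ _ _).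
  have cJ := etrans (congr1 (fun M : 'rV[R]_n => M 0 i) (fc _ _ vB uB vu))
    (mxDB _ _ _).
  rewrite f1// in cI; rewrite f2// in cJ.
  have bI := chiI e; have bJ := chiJ e.
  rewrite e0 eeI /= in bI; rewrite e0 eeJ /= in bJ.
  move: (bI isT) (bJ isT); rewrite cI cJ => bI' bJ'.
  exact: quadratic_part e0 gE bI' bJ'.
apply/eqP; rewrite -subr_eq0 -normr_le0; apply/ler_addgt0Pr => eta eta0.
rewrite add0r.
have /cvgrPdist_lt/(_ (eta / 2)) :
    (fun z => dg (Psi z) 0 i) @ ((0 : R), (0 : R)) --> d0.
  have Hd : dg @ Psi (0, 0) --> dg (Psi (0, 0)) by rewrite PsiE; exact: dgc.
  have := cvg_comp _ _ (cvg_comp _ _ Psic Hd) (@coord_continuous R 1 n 0 i _).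
  by rewrite PsiE.
rewrite divr_gt0// => /(_ isT)[[U1 U2] /= [/nbhs_ballP[r1 /= r10 r1U]
  /nbhs_ballP[r2 /= r20 r2U] UU]].
(* Choose e below the finitely many thresholds collected in [bnd]. *)
pose S := CI + CJ; pose B := `|S| + 1.
have B0 : 0 < B by rewrite ltr_wpDl.
pose bnd := [:: 1; (C1 + C2)^-1; eI; eJ; eX; eY; r1; r2; eta / 2 / B].
have [e e0 eb] : exists2 e, 0 < e & forall b, b \in bnd -> e < b.
  have : all (fun b => 0 < b) bnd.
    by rewrite /= ltr01 invr_gt0 addr_gt0// eI0 eJ0 eX0 eY0 r10 r20 !divr_gt0.
  elim: bnd => [|b s IH] /=; first by exists 1.
  move=> /andP[b0 /IH[e e0 es]]; exists (Num.min (b / 2) e).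
    by rewrite lt_min e0 divr_gt0.
  move=> d; rewrite inE => /predU1P[->|/es ed]; rewrite gt_min.
    by rewrite ltr_pdivrMr// ltr_pMr// ltr1n.
  by rewrite ed orbT.
have eB b (k : nat) : nth 0 bnd k = b -> (k < 9)%N -> e < b.
  by move=> <- k9; apply: eb; exact: mem_nth.
have e1 : e < 1 := eB _ 0%N erefl isT.
have eC : e * (C1 + C2) < 1.
  have := eB _ 1%N erefl isT.
  by rewrite /= -[_^-1]mul1r ltr_pdivlMr// addr_gt0.
have [t /andP[t0 te] dgt] := key e e0 e1 eC (eB _ 2 erefl isT)
  (eB _ 3 erefl isT) (eB _ 4 erefl isT) (eB _ 5 erefl isT).
have er1 := eB _ 6 erefl isT; have er2 := eB _ 7 erefl isT.
have eeta := eB _ 8 erefl isT.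
have te' : t <= e by rewrite (le_trans te)// expr2 ler_piMr// ltW.
have d0t : `|d0 - dg (Psi (e, t)) 0 i| < eta / 2.
  apply: (UU (e, t)); split => /=.
    by apply: r1U; rewrite /ball/= sub0r normrN gtr0_norm.
  by apply: r2U; rewrite /ball/= sub0r normrN ger0_norm// (le_lt_trans te').
have eS : e * S <= eta / 2.
  rewrite (@le_trans _ _ (e * B))//.
    by rewrite ler_pM2l// (le_trans (ler_norm _))// lerDl.
  by rewrite -ler_pdivlMr// ltW.
rewrite (splitr eta) -(subrKA (dg (Psi (e, t)) 0 i)).
by rewrite (le_trans (ler_normD _ _))// lerD ?(ltW d0t)// (le_trans dgt).
Qed.

End Nontriviality.

Section Conclusion.
Context {R : realType} (n : nat) (n0 : (0 < n)%N).

Lemma chi_not_coboundary : ~ coboundary (@chi R n).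
Proof.
move=> [f [g gC fg] fc]; have [_ [dg [gd dgc]]] := gC 1%N.
have adm0 : admissible (0 : {poly R}).
  by split; rewrite ?horner0// => t _; rewrite deriv0 horner0 addr0.
have dgc0 v : {for (poly_coords n 0, v), continuous dg}.
  exact: (dgc (poly_coords n 0, v) (poly_coords_dom n0 adm0)).
pose i : 'I_n := Ordinal n0.
(* Writing X = a q and Y = a r, the bracket is a^2 (q r' - r q'); the pairs
   (q, r) = (10, x^3) and (30 x, x^2) give the same value. With these
   coefficients the primitives of X' Y'' and Y' X'' have integer
   coefficients. *)
pose a : {poly R} := 'X - 'X^2.
pose X1 := a *+ 10; pose Y1 := a * 'X^3.
pose X2 := (a * 'X) *+ 30; pose Y2 := a * 'X^2.
have a0 : a.[0] = 0 by rewrite hornerD hornerN hornerX hornerXn expr0n subrr.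
have a1 : a.[1] = 0 by rewrite hornerD hornerN hornerX hornerXn expr1n subrr.
have X10 : X1.[0] = 0 by rewrite hornerMn a0 mul0rn.
have X11 : X1.[1] = 0 by rewrite hornerMn a1 mul0rn.
have Y10 : Y1.[0] = 0 by rewrite hornerM a0 mul0r.
have Y11 : Y1.[1] = 0 by rewrite hornerM a1 mul0r.
have X20 : X2.[0] = 0 by rewrite hornerMn hornerM a0 mul0r mul0rn.
have X21 : X2.[1] = 0 by rewrite hornerMn hornerM a1 mul0r mul0rn.
have Y20 : Y2.[0] = 0 by rewrite hornerM a0 mul0r.
have Y21 : Y2.[1] = 0 by rewrite hornerM a1 mul0r.
pose P (k l m : nat) : {poly R} := 'X^3 *+ k - 'X^4 *+ l + 'X^5 *+ m.
have P_val k l m : (P k l m).[1] - (P k l m).[0] = k%:R - l%:R + m%:R.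
  rewrite /P !(hornerD, hornerN, hornerMn, hornerXn) !expr1n !expr0n.
  by rewrite !mul0rn subrr addr0 subr0.
pose I1 := P 40 110 80; pose J1 := P 0 20 20.
pose I2 := P 120 315 216; pose J2 := P 60 195 144.
have I1E : I1^`() = X1^`() * Y1^`()^`().
  by rewrite /I1 /P /X1 /Y1 /a
    !(derivMn, derivD, derivN, derivM, derivXn, derivX, derivC) /=; ring.
have J1E : J1^`() = Y1^`() * X1^`()^`().
  by rewrite /J1 /P /X1 /Y1 /a
    !(derivMn, derivD, derivN, derivM, derivXn, derivX, derivC) /=; ring.
have I2E : I2^`() = X2^`() * Y2^`()^`().
  by rewrite /I2 /P /X2 /Y2 /a
    !(derivMn, derivD, derivN, derivM, derivXn, derivX, derivC) /=; ring.
have J2E : J2^`() = Y2^`() * X2^`()^`().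
  by rewrite /J2 /P /X2 /Y2 /a
    !(derivMn, derivD, derivN, derivM, derivXn, derivX, derivC) /=; ring.
have brE : X1 * Y1^`() - Y1 * X1^`() = X2 * Y2^`() - Y2 * X2^`().
  by rewrite /X1 /Y1 /X2 /Y2 /a
    !(derivMn, derivD, derivN, derivM, derivXn, derivX, derivC) /=; ring.
have E1 := @coboundary_bracket R n n0 X1 Y1 I1 J1 i g dg f X10 X11 Y10 Y11
  I1E J1E gd (dgc0 _) fg fc.
have E2 := @coboundary_bracket R n n0 X2 Y2 I2 J2 i g dg f X20 X21 Y20 Y21
  I2E J2E gd (dgc0 _) fg fc.
have om1 : (I1.[1] - I1.[0]) - (J1.[1] - J1.[0]) = 10 by rewrite !P_val; lra.
have om2 : (I2.[1] - I2.[0]) - (J2.[1] - J2.[0]) = 12 by rewrite !P_val; lra.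
have : 10 = 12 :> R by rewrite -om1 -E1 brE E2 om2.
by lra.
Qed.

End Conclusion.

Theorem theorem1p2 (R : realType) (n : nat) (n_ge1 : (1 <= n)%N) :
  [/\ is_groupoid (@Bconf R n) (@BDiff R n) (@src R n) (@trg R n)
        (@bcomp R n),
      cocycle (@chi R n),
      is_groupoid (@Bconf R n) [set a : ext_arrow R n | BDiff a.1]%classic
        (@ext_src R n) (@ext_trg R n) (ext_mul (@chi R n)) &
      ~ coboundary (@chi R n)].
Proof.
split.
- exact: BDiff_groupoid.
- exact: chi_cocycle.
- exact: extension_groupoid (@chi_cocycle R n) (@chi_unitl R n)
    (@chi_unitr R n).
- exact: chi_not_coboundary.
Qed.
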